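(* Let $p\in[1,\infty)$. Assume that $\nu$ is a non-negative, radially symmetric function on $\mathbb{R}^d$ with $\int_{\mathbb{R}^d}(1\wedge|x|^p)\,\nu(x)\,\mathrm{d}x<\infty$, whose radial profile has lower Matuszewska index at zero strictly bigger than $-d-1$. Then there is a constant $c>0$ such that for all $f\in W_p^{\nu}$, $$\int_{\mathbb{R}^d} |f(x)|^p\, h_p(|x|)\,\mathrm{d}x \le c\,\|f\|_{W_p^{\nu}}^p .$$
   Context: Functions are measurable. A radially symmetric function $\nu$ is identified with its radial profile, $\nu(x)=\nu(|x|)$, and with the measure $\nu(x)\,\mathrm{d}x$. For $r>0$, $$h_p(r)=\int_{\mathbb{R}^d}\left(1\wedge\frac{|x|^p}{r^p}\right)\nu(x)\,\mathrm{d}x .$$ The nonlocal Sobolev space is $W_p^{\nu}=\{f:\ \|f\|_{W_p^{\nu}}:=\|f\|_p+[f]_{W_p^{\nu}}<\infty\}$, where $\|f\|_p$ is the $L^p(\mathbb{R}^d)$ norm and $$[f]_{W_p^{\nu}}=\left(\int_{\mathbb{R}^d}\int_{\mathbb{R}^d}|f(x+h)-f(x)|^p\,\mathrm{d}x\,\nu(h)\,\mathrm{d}h\right)^{1/p}.$$ The lower Matuszewska index at zero of a function $\varphi:(0,\infty)\to(0,\infty)$ is the supremum of those $a\in\mathbb{R}$ for which there exist $A,R_0>0$ such that $\varphi(r_2)/\varphi(r_1)\ge A\,(r_2/r_1)^{a}$ whenever $0<r_1<r_2<R_0$. *)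

(* Defs.v *)
From HB Require Import structures.
From mathcomp Require Import all_boot all_order all_algebra.
From mathcomp Require Import all_classical all_reals all_analysis.

Set Implicit Arguments.
Unset Strict Implicit.
Unset Printing Implicit Defensive.
Import Order.TTheory GRing.Theory Num.Theory.
Import numFieldNormedType.Exports.
Local Open Scope classical_set_scope.
Local Open Scope ring_scope.

Definition measure_rV_display : measure_display -> measure_display.
Proof. exact. Qed.

(* The product sigma-algebra on row vectors, generated by the coordinates; for
   a realType R it is the Borel sigma-algebra of R^n. *)
Section measurable_rV.
Context {disp} {T : sigmaRingType disp}.
Variable n : nat.

Let coords : 'I_n -> 'rV[T]_n -> T := fun i x => x ord0 i.

Let rV_set0 : g_sigma_preimage coords set0.
Proof. exact: sigma_algebra0. Qed.

Let rV_setC A : g_sigma_preimage coords A -> g_sigma_preimage coords (~` A).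
Proof. exact: sigma_algebraC. Qed.

Let rV_bigcup (F : _^nat) : (forall i, g_sigma_preimage coords (F i)) ->
  g_sigma_preimage coords (\bigcup_i (F i)).
Proof. exact: sigma_algebra_bigcup. Qed.

HB.instance Definition _ := @isMeasurable.Build (measure_rV_display disp)
  'rV[T]_n (g_sigma_preimage coords) rV_set0 rV_setC rV_bigcup.

End measurable_rV.

Section lebesgue_rV.
Variable R : realType.

Lemma measurable_coord n (i : 'I_n) :
  measurable_fun [set: 'rV[R]_n] (fun x : 'rV[R]_n => x ord0 i).
Proof.
move=> _ Y mY; rewrite setTI; apply: sub_sigma_algebra => /=.
rewrite -bigcup_seq/=; exists i => /=; first by rewrite mem_index_enum.
by exists Y => //; rewrite setTI.
Qed.

Lemma measurable_fun_rV d (T : measurableType d) n (f : T -> 'rV[R]_n) :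
  (forall i, measurable_fun [set: T] (fun t => f t ord0 i)) ->
  measurable_fun [set: T] f.
Proof.
move=> mf _ Y mY; rewrite setTI.
suff : preimage_set_system [set: T] f
    (g_sigma_preimage (fun i (x : 'rV[R]_n) => x ord0 i)) `<=` measurable.
  by apply; exists Y => //; rewrite setTI.
rewrite -g_sigma_preimage_comp; apply: smallest_sub.
  exact: sigma_algebra_measurable.
rewrite -bigcup_seq => A [i _ [B mB <-]].
exact: mf.
Qed.

Definition cons_rV n (x : R * 'rV[R]_n) : 'rV[R]_n.+1 :=
  \row_i oapp (x.2 ord0) x.1 (unlift ord0 i).

Definition uncons_rV n (y : 'rV[R]_n.+1) : R * 'rV[R]_n :=
  (y ord0 ord0, \row_j y ord0 (lift ord0 j)).

Lemma cons_rVK n : cancel (@cons_rV n) (@uncons_rV n).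
Proof.
move=> [a v]; rewrite /uncons_rV mxE unlift_none; congr (_, _).
by apply/rowP => j; rewrite !mxE liftK.
Qed.

Lemma measurable_cons_rV n : measurable_fun setT (@cons_rV n).
Proof.
apply: measurable_fun_rV => i; under eq_fun do rewrite mxE.
case: (unliftP ord0 i) => [j|] _ /=; last exact: measurable_fst.
exact: (measurableT_comp (measurable_coord j) measurable_snd).
Qed.

Lemma measurable_uncons_rV n : measurable_fun setT (@uncons_rV n).
Proof.
apply: measurable_fun_pair; first exact: measurable_coord.
apply: measurable_fun_rV => i; under eq_fun do rewrite mxE.
exact: measurable_coord.
Qed.

Section step.
Local Open Scope ereal_scope.
Variables (n : nat) (mu : {sigma_finite_measure set 'rV[R]_n -> \bar R}).

Definition lebesgue_cons : set 'rV[R]_n.+1 -> \bar R :=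
  pushforward (lebesgue_measure \x mu) (@cons_rV n).

Let mcons0 : lebesgue_cons set0 = 0.
Proof. by rewrite /lebesgue_cons /pushforward preimage_set0 measure0. Qed.

Let mcons_ge0 A : 0 <= lebesgue_cons A.
Proof. exact: (measure_ge0 (lebesgue_measure \x mu)). Qed.

Let mcons_sigma_additive : semi_sigma_additive lebesgue_cons.
Proof.
move=> F mF tF mUF; rewrite /lebesgue_cons /pushforward preimage_bigcup.
apply: measure_semi_sigma_additive.
- by move=> k; rewrite -[X in measurable X]setTI; exact: measurable_cons_rV.
- apply/trivIsetP => /= i j _ _ ij; rewrite -preimage_setI.
  by move/trivIsetP : tF => /(_ _ _ _ _ ij) ->//; rewrite preimage_set0.
- rewrite -preimage_bigcup -[X in measurable X]setTI.
  exact: measurable_cons_rV.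
Qed.

HB.instance Definition _ := isMeasure.Build _ _ _ lebesgue_cons
  mcons0 mcons_ge0 mcons_sigma_additive.

Let mcons_sigma_finite : sigma_finite setT lebesgue_cons.
Proof.
have /sigma_finiteP[F [TF ndF Foo]] := sigma_finiteT (@lebesgue_measure R).
have /sigma_finiteP[G [TG ndG Goo]] := sigma_finiteT mu.
exists (fun k => @uncons_rV n @^-1` (F k `*` G k)).
  rewrite -preimage_bigcup (_ : \bigcup_i _ = setT) ?preimage_setT//.
  rewrite -subTset => -[x y] _.
  have [k _ Fkx] : (\bigcup_k F k) x by rewrite -TF.
  have [l _ Gly] : (\bigcup_k G k) y by rewrite -TG.
  exists (maxn k l) => //; split => /=.
  - by move: x Fkx; exact/subsetPset/ndF/leq_maxl.
  - by move: y Gly; exact/subsetPset/ndG/leq_maxr.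
move=> k; have [mFk Fkoo] := Foo k; have [mGk Gkoo] := Goo k; split.
  rewrite -[X in measurable X]setTI; apply: measurable_uncons_rV => //.
  exact: measurableX.
rewrite /lebesgue_cons /pushforward -comp_preimage.
rewrite (_ : _ \o _ = id); last by apply/funext => x; exact: cons_rVK.
by rewrite preimage_id product_measure1E// lte_mul_pinfty// ge0_fin_numE.
Qed.

HB.instance Definition _ := Measure_isSigmaFinite.Build _ _ _ lebesgue_cons
  mcons_sigma_finite.

End step.

(* Lebesgue measure on R^n: the n-fold product of lebesgue_measure (restricted
   to Borel sets), a unit mass on the one-point space R^0. *)
Fixpoint lebesgue_rV (n : nat) : {sigma_finite_measure set 'rV[R]_n -> \bar R} :=
  match n with
  | 0 => \d_(0 : 'rV[R]_0)
  | m.+1 => lebesgue_cons (lebesgue_rV m)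
  end.

End lebesgue_rV.

Section nonlocal_sobolev.
Context {R : realType} {d : nat}.
Local Open Scope ereal_scope.
Implicit Types (p r : R) (nu : R -> R) (f : 'rV[R]_d -> R).

Local Notation leb := (lebesgue_rV R d).

(* The Euclidean norm; the canonical norm `|x| of 'rV[R]_d is the sup norm. *)
Definition enorm (x : 'rV[R]_d) : R :=
  Num.sqrt (\sum_(i < d) x ord0 i ^+ 2)%R.

(* Throughout, nu is the radial profile of the function nu (enorm x) on R^d. *)
Definition hfun nu p r : \bar R :=
  \int[leb]_x (Num.min 1 (enorm x `^ p / r `^ p) * nu (enorm x))%:E.

Definition seminormW nu p f : \bar R :=
  (\int[leb]_h ((\int[leb]_x (`|f (x + h) - f x| `^ p)%:E)
                * (nu (enorm h))%:E)) `^ p^-1.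

Definition normW nu p f : \bar R :=
  'N[leb]_(p%:E)[EFin \o f] + seminormW nu p f.

Definition spaceW nu p : set ('rV[R]_d -> R) :=
  [set f | measurable_fun [set: 'rV[R]_d] f /\ normW nu p f < +oo].

End nonlocal_sobolev.

(* Since x / 0 = 0, an admissible exponent forces phi != 0 near 0. The
   supremum may be +oo, and it is -oo when there is no admissible exponent. *)
Definition lower_Matuszewska0 (R : realType) (phi : R -> R) : \bar R :=
  ereal_sup [set a%:E | a in [set a : R | exists A R0 : R,
    [/\ 0 < A, 0 < R0 & forall r1 r2 : R, 0 < r1 -> r1 < r2 -> r2 < R0 ->
      A * (r2 / r1) `^ a <= phi r2 / phi r1]]].

(* Main.v *)
(* Near the origin [h_p(r)] is comparable with [nu(|h| > r) + r^d nu(r)]. For a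
   jump kernel [k x h <= K nu(h)] with weight [W x = int k x h dh], the bound
   [|f x|^p <= 6/5 |f (x+h)|^p + C |f (x+h) - f x|^p] gives
   [int |f|^p W <= 6/5 int |f y|^p (int k (y-h) h dh) dy + C K [f]^p],
   which absorbs once [int k (y-h) h dh <= 5/8 W y + B]. The kernel used is the
   sum of two. Jumps with [|h| > |x|] have as weight the tail [nu(|h| > |x|)];
   those landing at [y] come from a half-space of [h]'s, hence carry at most half
   of the tail at [|y| / 2]. Jumps from [x] with [|h|] of order [M |x|] and
   density [nu(x)] have a weight of order [|x|^d nu(x)], and what lands at [y] is
   smaller by a factor of order [M^(b-2d)], where [nu(s) <= C (r/s)^b nu(r)] for
   [s <= r] small; the index hypothesis provides some [b < d + 1 <= 2 d]. All
   weights are truncated at [|x| > t], which makes the absorption legitimate,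
   and [t] tends to [0] at the end. *)

Require Import Defs.
From HB Require Import structures.
From mathcomp Require Import all_boot all_order all_algebra.
From mathcomp Require Import all_classical all_reals all_analysis.
From mathcomp Require Import measurable_realfun ring lra.

Set Implicit Arguments.
Unset Strict Implicit.
Unset Printing Implicit Defensive.
Import Order.TTheory GRing.Theory Num.Theory.
Import numFieldNormedType.Exports.
Local Open Scope classical_set_scope.
Local Open Scope ring_scope.

(** * Affine changes of variables for Lebesgue measure *)

Section change_of_variables.
Context {R : realType}.
Local Open Scope ereal_scope.
Local Notation mu := (@lebesgue_measure R).

Let affine (t b : R) : measurableTypeR R -> measurableTypeR R :=
  fun x => (t * x + b)%R.

Let measurable_affine t b : measurable_fun setT (affine t b).
Proof.
have : measurable_fun [set: R] (fun x => t * x + b)%R by apply: measurable_funD.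
by move=> H; apply: H => x; exact: F0.
Qed.

(** The pushforward along [affine t b], scaled by |t|, agrees with Lebesgue measure on half-open
    intervals, and these determine the measure. *)
Lemma lebesgue_measure_affine (t b : R) (A : set R) : t != 0%R ->
  measurable A -> mu A = `|t|%:E * mu (affine t b @^-1` A).
Proof.
move=> t0 mA.
pose nu := mscale (NngNum (normr_ge0 t)) (pushforward mu (affine t b)).
suff : mu A = nu (measurable_affine t b) A by [].
apply: lebesgue_measure_unique => // _ [[u v]] _ <-.
rewrite /nu /mscale /pushforward.
rewrite -[RHS]/(`|t|%:E * mu (affine t b @^-1` `]u, v]%classic)) -[LHS]/(mu `]u, v]%classic).
have [tp|tn|t00] := ltgtP 0%R t; last by rewrite t00 eqxx in t0.
- rewrite (_ : affine t b @^-1` _ = `](u - b) / t, (v - b) / t]%classic)%R; last first.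
    by apply/seteqP; split => x /=; rewrite /affine !in_itv/= ltr_pdivrMr// ler_pdivlMr//;
      move=> /andP[? ?]; apply/andP; split; lra.
  rewrite !lebesgue_measure_itv/= !lte_fin ltr_pM2r ?invr_gt0// ltrD2r.
  case: ifPn => uv; last by rewrite mule0.
  by rewrite -!EFinD -EFinM gtr0_norm//; congr EFin; field.
(* A negative [t] reverses the interval, so the closed end changes sides; the length is
   unaffected. *)
- rewrite (_ : affine t b @^-1` _ = `[(v - b) / t, (u - b) / t[%classic)%R; last first.
    by apply/seteqP; split => x /=; rewrite /affine !in_itv/= ler_ndivrMr// ltr_ndivlMr//;
      move=> /andP[? ?]; apply/andP; split; lra.
  rewrite !lebesgue_measure_itv/= !lte_fin ltr_nM2r ?invr_lt0// ltrD2r.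
  case: ifPn => uv; last by rewrite mule0.
  by rewrite -!EFinD -EFinM ltr0_norm//; congr EFin; field.
Qed.

Lemma ge0_integral_affine (t b : R) (F : measurableTypeR R -> \bar R) : t != 0%R ->
  measurable_fun setT F -> (forall x, 0 <= F x) ->
  `|t|%:E * \int[mu]_x F (t * x + b)%R = \int[mu]_x F x.
Proof.
move=> t0 mF F0.
pose nu := mscale (NngNum (normr_ge0 t)) (pushforward mu (affine t b)).
transitivity (\int[nu (measurable_affine t b)]_x F x).
  rewrite ge0_integral_mscale//=; congr (_ * _).
  by rewrite (ge0_integral_pushforward (measurable_affine t b)).
by apply: eq_measure_integral => //= A mA _; rewrite [RHS](lebesgue_measure_affine b t0).
Qed.

(** Tonelli for the product measure that [cons_rV] transports; this is what drives inductions on the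
    dimension. *)
Lemma integral_lebesgue_cons n (F : 'rV[R]_n.+1 -> \bar R) :
  measurable_fun setT F -> (forall x, 0 <= F x) ->
  \int[lebesgue_rV R n.+1]_x F x =
  \int[mu]_u \int[lebesgue_rV R n]_v F (cons_rV (u, v)).
Proof.
move=> mF F0; rewrite [LHS]ge0_integral_pushforward//=; last exact: measurable_cons_rV.
rewrite fubini_tonelli1//=.
exact: (measurableT_comp mF (@measurable_cons_rV R n)).
Qed.

Lemma measurable_cons_rV_comp n (F : 'rV[R]_n.+1 -> \bar R) :
  measurable_fun setT F ->
  measurable_fun [set: measurableTypeR R * 'rV[R]_n] (F \o @cons_rV R n).
Proof. by move=> mF; exact: (measurableT_comp mF (@measurable_cons_rV R n)). Qed.

Lemma measurable_integral_cons_rV n (F : 'rV[R]_n.+1 -> \bar R) :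
  measurable_fun setT F -> (forall x, 0 <= F x) ->
  measurable_fun setT
    (fun u : measurableTypeR R => \int[lebesgue_rV R n]_v F (cons_rV (u, v))).
Proof.
move=> mF F0.
have := measurable_fun_fubini_tonelli_F (m2 := lebesgue_rV R n) (F \o @cons_rV R n)
  (measurable_cons_rV_comp mF).
by move=> H; apply: H => x; exact: F0.
Qed.

Lemma measurable_affine_rV n (t : R) (b : 'rV[R]_n) :
  measurable_fun setT (fun x : 'rV[R]_n => t *: x + b)%R.
Proof.
apply: measurable_fun_rV => i; under eq_fun do rewrite !mxE.
by apply: measurable_funD => //; apply: measurable_funM => //; exact: measurable_coord.
Qed.

(** Splitting off the first coordinate yields one factor |t| per dimension; dimension 0 is a single
    point. The translations, reflections and dilations below are all instances. *)
Lemma ge0_integral_affine_rV n (t : R) (b : 'rV[R]_n) (F : 'rV[R]_n -> \bar R) :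
  t != 0%R -> measurable_fun setT F -> (forall x, 0 <= F x) ->
  (`|t| ^+ n)%:E * \int[lebesgue_rV R n]_x F (t *: x + b)%R =
  \int[lebesgue_rV R n]_x F x.
Proof.
move=> t0; elim: n b F => [|n IH] b F mF F0.
  by rewrite expr0 mul1e; apply: eq_integral => x _; congr F; apply/rowP => -[].
have mG : measurable_fun setT (fun x : 'rV[R]_n.+1 => F (t *: x + b)%R).
  exact: (measurableT_comp mF (measurable_affine_rV t b)).
rewrite !integral_lebesgue_cons//.
pose H (u : measurableTypeR R) := \int[lebesgue_rV R n]_v F (cons_rV (u, v)).
have mH : measurable_fun setT H by exact: measurable_integral_cons_rV.
have H0 u : 0 <= H u by exact: integral_ge0.
rewrite -[RHS](ge0_integral_affine (b ord0 ord0) t0 mH H0).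
rewrite exprS EFinM -muleA; congr (_ * _).
rewrite -ge0_integralZl//; last 2 first.
- exact: (measurable_integral_cons_rV mG).
- by move=> x _; exact: integral_ge0.
apply: eq_integral => u _.
rewrite /H -[RHS](IH (\row_j b ord0 (lift ord0 j))%R) //; last first.
  exact: (measurableT_comp (measurable_cons_rV_comp mF) (measurable_pair1 _)).
congr (_ * _); apply: eq_integral => v _; congr F.
by apply/rowP => i; rewrite !mxE; case: (unliftP ord0 i) => [j|] -> /=; rewrite ?mxE.
Qed.

End change_of_variables.

(** * The Euclidean norm: parallelogram law and triangle inequality *)

Section euclidean_norm.
Context {R : realType} {d : nat}.
Implicit Types (x y : 'rV[R]_d) (r t : R).

Lemma enorm_ge0 x : 0 <= enorm x.
Proof. exact: sqrtr_ge0. Qed.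

Lemma sqr_enorm x : enorm x ^+ 2 = \sum_(i < d) x ord0 i ^+ 2.
Proof. by rewrite sqr_sqrtr// sumr_ge0// => i _; exact: sqr_ge0. Qed.

Lemma enorm_eq0 x : (enorm x == 0) = (x == 0).
Proof.
rewrite -(sqrf_eq0 (enorm x)) sqr_enorm psumr_eq0; last by move=> i _; exact: sqr_ge0.
apply/allP/eqP => [x0|-> i _]; last by rewrite mxE expr0n eqxx implybT.
by apply/rowP => i; have := x0 i (mem_index_enum i); rewrite sqrf_eq0 mxE => /eqP.
Qed.

Lemma enormZ t x : enorm (t *: x) = `|t| * enorm x.
Proof.
rewrite /enorm -sqrtr_sqr -sqrtrM ?sqr_ge0// mulr_sumr; congr Num.sqrt.
by apply: eq_bigr => i _; rewrite mxE exprMn.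
Qed.

Lemma enormN x : enorm (- x) = enorm x.
Proof. by rewrite -scaleN1r enormZ normrN1 mul1r. Qed.

Lemma sqr_enormD t x y : enorm (x + t *: y) ^+ 2 =
  enorm x ^+ 2 + 2 * t * (\sum_(i < d) x ord0 i * y ord0 i) + t ^+ 2 * enorm y ^+ 2.
Proof.
rewrite !sqr_enorm !mulr_sumr -!big_split/=; apply: eq_bigr => i _.
by rewrite !mxE; ring.
Qed.

Lemma enorm_parallelogram x y :
  enorm (x - y) ^+ 2 + enorm (x + y) ^+ 2 = 2 * (enorm x ^+ 2 + enorm y ^+ 2).
Proof.
have := sqr_enormD (-1) x y; have := sqr_enormD 1 x y.
by rewrite scaleN1r scale1r => -> ->; ring.
Qed.

Lemma ler_enormD x y : enorm (x + y) <= enorm x + enorm y.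
Proof.
have [/eqP|x0] := eqVneq (enorm x) 0.
  by rewrite enorm_eq0 => /eqP ->; rewrite add0r lerDr enorm_ge0.
have [/eqP|y0] := eqVneq (enorm y) 0.
  by rewrite enorm_eq0 => /eqP ->; rewrite addr0 lerDl enorm_ge0.
have a0 : 0 < enorm x by rewrite lt_def x0 enorm_ge0.
have b0 : 0 < enorm y by rewrite lt_def y0 enorm_ge0.
(* Cauchy-Schwarz: the squared norm of x - (|x|/|y|) y equals 2 (|x|/|y|) (|x||y| - S). *)
have := sqr_ge0 (enorm (x + - (enorm x / enorm y) *: y)); rewrite sqr_enormD.
set S := \sum_(i < d) _ => H.
have : 0 <= 2 * (enorm x / enorm y) * (enorm x * enorm y - S).
  by apply: (le_trans H); rewrite le_eqVlt; apply/orP; left; apply/eqP; field.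
rewrite pmulr_rge0 ?mulr_gt0 ?invr_gt0// => ?.
rewrite -ler_sqr ?nnegrE ?addr_ge0 ?enorm_ge0//.
by have := sqr_enormD 1 x y; rewrite scale1r => ->; rewrite -/S; lra.
Qed.

Lemma measurable_enorm : measurable_fun [set: 'rV[R]_d] (@enorm R d).
Proof.
apply: (measurableT_comp (f := @Num.sqrt R)).
  apply: continuous_measurable_fun; exact: sqrt_continuous.
rewrite (_ : (fun x : 'rV[R]_d => _) =
   (fun x : 'rV[R]_d => \sum_(i <- index_enum 'I_d) x ord0 i ^+ 2))//.
apply: measurable_sum => i; apply: measurable_funX; exact: measurable_coord.
Qed.

End euclidean_norm.

(** * Volume of Euclidean balls, with indicators written as booleans cast to [R] *)

Section ball_volume.
Context {R : realType}.
Local Open Scope ereal_scope.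

Lemma measurable_natr_bool d (T : measurableType d) (b : T -> bool) :
  measurable_fun setT b -> measurable_fun setT (fun x => (b x)%:R : R)%R.
Proof.
move=> mb; rewrite (_ : (fun x => _) = (fun x => if b x then 1 else 0)%R).
  exact: measurable_fun_ifT.
by apply/funext => x; case: (b x).
Qed.

Lemma integral_bool d (T : measurableType d) (mu : {measure set T -> \bar R})
    (b : T -> bool) : measurable_fun setT b ->
  \int[mu]_x ((b x)%:R)%:E = mu [set x | b x].
Proof.
move=> mb; have mB : measurable [set x | b x].
  by have := mb measurableT [set true] I; rewrite setTI.
rewrite -[[set x | b x] in RHS]setIT -integral_indic//; apply: eq_integral => x _.
by rewrite indicE; congr (nat_of_bool _)%:R%:E; apply/idP/idP; rewrite !inE.
Qed.

Lemma measurable_enorm_le d (r : R) :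
  measurable_fun setT (fun x : 'rV[R]_d => (enorm x <= r)%R).
Proof. by apply: measurable_fun_ler => //; exact: measurable_enorm. Qed.

Lemma measurable_cube d (r : R) :
  measurable [set x : 'rV[R]_d | forall i, (`|x ord0 i| <= r)%R].
Proof.
rewrite (_ : [set _ | _] = \big[setI/setT]_(i < d) [set x : 'rV[R]_d | (`|x ord0 i| <= r)%R]); last first.
  rewrite -bigcap_seq; apply/seteqP; split => x /= H; first by move=> i _; exact: H.
  by move=> i; apply: H; exact: mem_index_enum.
apply: bigsetI_measurable => i _.
have := measurable_fun_ler (measurableT_comp (@normr_measurable R setT) (measurable_coord i)) (measurable_cst r).
by move=> /(_ measurableT [set true] I); rewrite setTI.
Qed.

Lemma lebesgue_rV_cube d (r : R) : (0 < r)%R ->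
  lebesgue_rV R d [set x | forall i, (`|x ord0 i| <= r)%R] = ((2 * r) ^+ d)%:E.
Proof.
move=> r0; elim: d => [|n IH].
  by rewrite expr0 /= diracE mem_set// => -[].
have E : @cons_rV R n @^-1` [set x : 'rV[R]_n.+1 | forall i, (`|x ord0 i| <= r)%R] =
    `[(- r)%R, r]%classic `*` [set x : 'rV[R]_n | forall i, (`|x ord0 i| <= r)%R].
  apply/seteqP; split => -[u v] /=.
    move=> H; split.
      by have := H ord0; rewrite mxE unlift_none/= in_itv/= ler_norml.
    by move=> i; have := H (lift ord0 i); rewrite mxE liftK.
  by rewrite in_itv/= -ler_norml => -[H1 H2] i; rewrite mxE; case: (unliftP ord0 i) => [j|] _ /=.
rewrite [LHS](_ : _ = (lebesgue_measure \x lebesgue_rV R n) (`[(- r)%R, r]%classic `*` [set x : 'rV[R]_n | forall i, (`|x ord0 i| <= r)%R])); last by rewrite -E.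
rewrite product_measure1E//; last exact: measurable_cube.
rewrite IH exprS EFinM; congr (_ * _).
have := lebesgue_measure_itv (`[(- r)%R, r] : interval R).
rewrite /= lte_fin ifT; last by lra.
by move=> ->; rewrite -EFinD; congr EFin; lra.
Qed.

(** [V] is the volume of the unit ball, and the power of r comes from a dilation. It is positive and
    finite because the unit ball lies between two cubes. *)
Lemma ball_volume d : exists V : R, (0 < V)%R /\ forall r : R, (0 < r)%R ->
  \int[lebesgue_rV R d]_x ((enorm x <= r)%R%:R)%:E = (V * r ^+ d)%:E.
Proof.
pose mu := lebesgue_rV R d.
pose B := [set x : 'rV[R]_d | (enorm x <= 1)%R].
have mB : measurable B.
  by have := @measurable_enorm_le d 1 => /(_ measurableT [set true] I); rewrite setTI.
have Boo : mu B < +oo.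
  apply: (@le_lt_trans _ _ (mu [set x | forall i, (`|x ord0 i| <= 1)%R])).
    apply: le_measure; rewrite ?inE//; first exact: measurable_cube.
    move=> x /= x1 i; apply: le_trans x1.
    rewrite -ler_sqr ?nnegrE ?enorm_ge0// sqr_enorm (bigD1 i)//= real_normK ?num_real//.
    by rewrite lerDl sumr_ge0// => j _; exact: sqr_ge0.
  by rewrite lebesgue_rV_cube// ltry.
have B0 : 0 < mu B.
  (* Half-side 1/(d+1) keeps the sum of squares at most d/(d+1), and still makes sense when d =
     0. *)
  have t0 : (0 < (d.+1%:R)^-1 :> R)%R by rewrite invr_gt0 ltr0n.
  apply: (@lt_le_trans _ _ (mu [set x | forall i, (`|x ord0 i| <= d.+1%:R^-1)%R])).
    by rewrite lebesgue_rV_cube// lte_fin exprn_gt0// mulr_gt0.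
  apply: le_measure; rewrite ?inE//; first exact: measurable_cube.
  move=> x /= H; rewrite /B/= -(@ler_sqr _ _ 1%R) ?nnegrE ?enorm_ge0// sqr_enorm.
  apply: (@le_trans _ _ (\sum_(i < d) d.+1%:R^-1)%R).
    apply: ler_sum => i _; rewrite -real_normK ?num_real//.
    apply: (@le_trans _ _ (d.+1%:R^-1 ^+ 2)%R); first by rewrite lerXn2r ?nnegrE// ltW.
    by rewrite expr2 ler_piMl ?(ltW t0)// invf_le1 ?ler1n ?ltr0n.
  rewrite sumr_const card_ord expr1n -[leLHS]mulr_natl ler_pdivrMr ?ltr0n// mul1r ler_nat.
  exact: leqnSn.
exists (fine (mu B)); split; first by rewrite fine_gt0// B0.
move=> r r0; rewrite mulrC EFinM fineK ?ge0_fin_numE//.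
rewrite -integral_bool; last exact: measurable_enorm_le.
rewrite -(ge0_integral_affine_rV 0%R (lt0r_neq0 r0))//; last first.
  apply/measurable_EFinP; apply: measurable_natr_bool; exact: measurable_enorm_le.
rewrite gtr0_norm//; congr (_ * _); apply: eq_integral => x _ /=.
by rewrite addr0 enormZ gtr0_norm// -[X in (_ <= X)%R](mulr1 r) ler_pM2l.
Qed.

End ball_volume.

(** * Absorption for jump kernels *)

Section absorption.
Context {R : realType}.

Lemma powR_le (p x y : R) : 0 <= p -> 0 <= x -> x <= y -> x `^ p <= y `^ p.
Proof.
by move=> p0 x0 xy; apply: ge0_ler_powR; rewrite ?nnegrE//; exact: le_trans xy.
Qed.

(** Either |v - u| <= t|u|, so that |u| <= |v|/(1 - t), or |u| < |v - u|/t. The factor 6/5 is small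
    enough for the absorption: times 5/8 it gives 3/4. *)
Lemma powR_le_split (p : R) : 0 < p -> exists C : R, 0 < C /\
  forall u v : R, `|u| `^ p <= 6 / 5 * `|v| `^ p + C * `|v - u| `^ p.
Proof.
move=> p0; pose L : R := (6 / 5) `^ p^-1.
have L1 : 1 < L.
  have <- : (1 : R) `^ p^-1 = 1 by rewrite powR1.
  by apply: gt0_ltr_powR; rewrite ?invr_gt0 ?nnegrE//; lra.
have L0 : 0 < L by lra.
(* Chosen so that 1/(1 - t) = L, whose p-th power is 6/5. *)
pose t := 1 - L^-1.
have t0 : 0 < t by rewrite subr_gt0 invf_lt1.
exists (t^-1 `^ p); split; first by rewrite powR_gt0 ?invr_gt0.
move=> u v; have [uv|uv] := lerP `|v - u| (t * `|u|).
  apply: (@le_trans _ _ (6 / 5 * `|v| `^ p)); last by rewrite lerDl mulr_ge0 ?powR_ge0.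
  have -> : 6 / 5 = L `^ p by rewrite -powRrM mulVf ?gt_eqF// powRr1//; lra.
  rewrite -powRM ?(ltW L0)//; apply: powR_le => //; first exact: ltW.
  rewrite -ler_pdivrMl//.
  have : `|u| <= `|v| + `|v - u| by rewrite -{1}(subKr v u) ler_normB.
  by rewrite /t in uv; lra.
apply: (@le_trans _ _ (t^-1 `^ p * `|v - u| `^ p)); last first.
  by rewrite lerDr mulr_ge0 ?powR_ge0//; lra.
rewrite -powRM ?invr_ge0 ?(ltW t0)//; apply: powR_le => //; first exact: ltW.
by rewrite ler_pdivlMl// ltW.
Qed.

Lemma ge0_integral_lincomb d0 (T : measurableType d0) (mu : {measure set T -> \bar R})
    (a b : R) (F G : T -> \bar R) : 0 <= a -> 0 <= b ->
  measurable_fun setT F -> measurable_fun setT G ->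
  (forall x, 0 <= F x)%E -> (forall x, 0 <= G x)%E ->
  (\int[mu]_x (a%:E * F x + b%:E * G x) =
   a%:E * \int[mu]_x F x + b%:E * \int[mu]_x G x)%E.
Proof.
move=> a0 b0 mF mG F0 G0; rewrite ge0_integralD//.
- by rewrite !ge0_integralZl// lee_fin.
- by move=> x _; rewrite mule_ge0 ?lee_fin.
- exact: measurable_funeM.
- by move=> x _; rewrite mule_ge0 ?lee_fin.
- exact: measurable_funeM.
Qed.

Context {d : nat}.
Local Open Scope ereal_scope.
Local Notation mu := (lebesgue_rV R d).
Local Notation V := 'rV[R]_d.

Lemma measurable_addrV :
  measurable_fun [set: V * V] (fun z : V * V => z.1 + z.2)%R.
Proof.
apply: measurable_fun_rV => i; under eq_fun do rewrite mxE.
by apply: measurable_funD; [exact: (measurableT_comp (measurable_coord i) measurable_fst)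
                           |exact: (measurableT_comp (measurable_coord i) measurable_snd)].
Qed.

Lemma measurable_subrV :
  measurable_fun [set: V * V] (fun z : V * V => z.1 - z.2)%R.
Proof.
apply: measurable_fun_rV => i; under eq_fun do rewrite !mxE.
by apply: measurable_funB; [exact: (measurableT_comp (measurable_coord i) measurable_fst)
                           |exact: (measurableT_comp (measurable_coord i) measurable_snd)].
Qed.

Lemma measurable_integral_snd (F : V * V -> \bar R) :
  measurable_fun setT F -> (forall z, 0 <= F z) ->
  measurable_fun setT (fun x => \int[mu]_h F (x, h)).
Proof. by move=> mF F0; exact: (measurable_fun_fubini_tonelli_F F mF F0). Qed.

Lemma ge0_integral_shift (b : V) (F : V -> \bar R) :
  measurable_fun setT F -> (forall x, 0 <= F x) ->
  \int[mu]_x F (x + b)%R = \int[mu]_x F x.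
Proof.
move=> mF F0; rewrite -(ge0_integral_affine_rV b (oner_neq0 R) mF F0).
by rewrite normr1 expr1n mul1e; under [RHS]eq_integral do rewrite scale1r.
Qed.

Lemma ge0_integral_opp (F : V -> \bar R) :
  measurable_fun setT F -> (forall x, 0 <= F x) ->
  \int[mu]_x F (- x)%R = \int[mu]_x F x.
Proof.
move=> mF F0; have t0 : (-1 != 0 :> R)%R by rewrite oppr_eq0 oner_neq0.
rewrite -(ge0_integral_affine_rV 0%R t0 mF F0).
by rewrite normrN1 expr1n mul1e; under [RHS]eq_integral do rewrite scaleN1r addr0.
Qed.

(* [k x h] is a jump kernel dominated by [v h]; [f] is compared at [x] and at
   the landing point [x + h], and the mass that [k] brings into each point is
   only a fraction 5/8 of the mass that leaves it, up to [B]. *)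
Lemma kernel_absorption (p : R) : (0 < p)%R -> exists C : R, (0 < C)%R /\
  forall (v : V -> R) (k : V -> V -> R) (f : V -> R) (K B D : R),
  (0 <= K)%R -> (0 <= B)%R ->
  measurable_fun setT v -> (forall h, 0 <= v h)%R ->
  measurable_fun setT (fun z : V * V => k z.1 z.2) ->
  (forall x h, 0 <= k x h)%R -> (forall x h, k x h <= K * v h)%R ->
  (forall x, \int[mu]_h (k x h)%:E <= D%:E) ->
  (forall y, \int[mu]_h (k (y - h) h)%R%:E <=
    (5 / 8)%:E * \int[mu]_h (k y h)%:E + B%:E) ->
  measurable_fun setT f -> \int[mu]_x (`|f x| `^ p)%:E < +oo ->
  \int[mu]_x ((`|f x| `^ p)%:E * \int[mu]_h (k x h)%:E) <=
    (C * K)%:E * (\int[mu]_h ((\int[mu]_x (`|f (x + h)%R - f x| `^ p)%:E) * (v h)%:E))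
    + (C * B)%:E * \int[mu]_x (`|f x| `^ p)%:E.
Proof.
move=> p0; have [C [C0 HC]] := powR_le_split p0.
(* The proof reaches I0 <= 3/4 I0 + 6/5 B G + C K S, that is I0 <= 24/5 B G + 4 C K S; one constant
   dominates both coefficients. *)
exists (5 + 4 * C)%R; split; first by lra.
move=> v k f K B D K0 B0 mv v0 mk k0 kv kD kB mf foo.
pose g x := (`|f x| `^ p)%R.
have g0 x : (0 <= g x)%R by exact: powR_ge0.
have mg : measurable_fun setT g.
  by apply: (measurableT_comp (measurable_powR _)); exact: measurableT_comp.
pose w x := \int[mu]_h (k x h)%:E.
have w0 x : 0 <= w x by apply: integral_ge0 => h _; rewrite lee_fin.
have mkE : measurable_fun setT (fun z : V * V => (k z.1 z.2)%:E) by exact/measurable_EFinP.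
have mw : measurable_fun setT w.
  by apply: (measurable_integral_snd mkE) => z; rewrite lee_fin.
have mkx x : measurable_fun setT (k x) by exact: (measurableT_comp mk (measurable_pair1 x)).
pose G := \int[mu]_x (g x)%:E.
pose S := \int[mu]_h ((\int[mu]_x (`|f (x + h)%R - f x| `^ p)%:E) * (v h)%:E).
pose I0 := \int[mu]_x ((g x)%:E * w x).
rewrite -/G -/S -/I0.
have mgE : measurable_fun setT (EFin \o g) by exact/measurable_EFinP.
(* Subtracting 3/4 I0 requires a finite I0. The bound [D] supplies this finiteness and does not
   enter the final estimate. *)
have I0_fin : I0 \is a fin_num.
  rewrite ge0_fin_numE; last by apply: integral_ge0 => x _; rewrite mule_ge0 ?lee_fin.
  apply: (@le_lt_trans _ _ (\int[mu]_x ((g x)%:E * D%:E))).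
    apply: ge0_le_integral => //.
    - by move=> x _; rewrite mule_ge0 ?lee_fin.
    - exact: emeasurable_funM.
    - exact: emeasurable_funM.
    - by move=> x _; rewrite lee_wpmul2l ?lee_fin// kD.
  have D0 : (0 <= D)%R by rewrite -lee_fin; exact: le_trans (w0 0%R) (kD 0%R).
  under eq_integral do rewrite muleC.
  rewrite ge0_integralZl//; last by move=> x _; rewrite lee_fin.
  by rewrite lte_mul_pinfty ?lee_fin.
have madd : measurable_fun setT (fun z : V * V => f (z.1 + z.2)%R).
  exact: (measurableT_comp mf measurable_addrV).
have mgadd : measurable_fun setT (fun z : V * V => g (z.1 + z.2)%R).
  exact: (measurableT_comp mg measurable_addrV).
pose F1 (z : V * V) := (g (z.1 + z.2)%R * k z.1 z.2)%:E.
have F10 z : 0 <= F1 z by rewrite lee_fin mulr_ge0.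
have mF1 : measurable_fun setT F1 by apply/measurable_EFinP; exact: measurable_funM.
pose F2 (z : V * V) := (`|f (z.1 + z.2)%R - f z.1| `^ p * v z.2)%:E.
have F20 z : 0 <= F2 z by rewrite lee_fin mulr_ge0 ?powR_ge0.
have mdf : measurable_fun setT (fun z : V * V => `|f (z.1 + z.2)%R - f z.1| `^ p)%R.
  apply: (measurableT_comp (measurable_powR _)); apply: measurableT_comp => //.
  by apply: measurable_funB => //; exact: (measurableT_comp mf measurable_fst).
have mF2 : measurable_fun setT F2.
  by apply/measurable_EFinP; apply: measurable_funM => //; exact: (measurableT_comp mv measurable_snd).
have mF1x x : measurable_fun setT (fun h => F1 (x, h)).
  exact: (measurableT_comp mF1 (measurable_pair1 x)).
have mF2x x : measurable_fun setT (fun h => F2 (x, h)).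
  exact: (measurableT_comp mF2 (measurable_pair1 x)).
(* The pointwise inequality with u = f x and v = f (x + h), integrated against [k]; in the
   difference term [k] is then replaced by [K * v h]. *)
have step1 : I0 <= (6 / 5)%:E * (\int[mu]_x \int[mu]_h F1 (x, h))
    + (C * K)%:E * (\int[mu]_x \int[mu]_h F2 (x, h)).
  have m1 : measurable_fun setT (fun x => \int[mu]_h F1 (x, h)).
    exact: (measurable_integral_snd mF1 F10).
  have m2 : measurable_fun setT (fun x => \int[mu]_h F2 (x, h)).
    exact: (measurable_integral_snd mF2 F20).
  have i1 x : 0 <= \int[mu]_h F1 (x, h) by apply: integral_ge0.
  have i2 x : 0 <= \int[mu]_h F2 (x, h) by apply: integral_ge0.
  have c1 : (0 <= 6 / 5 :> R)%R by lra.
  have c2 : (0 <= C * K)%R by rewrite mulr_ge0// ltW.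
  rewrite -ge0_integral_lincomb//.
  apply: ge0_le_integral => //.
  - by move=> x _; rewrite mule_ge0 ?lee_fin.
  - exact: emeasurable_funM.
  - by apply: emeasurable_funD; exact: measurable_funeM.
  move=> x _; rewrite -ge0_integral_lincomb// /w -ge0_integralZl ?lee_fin//; last 2 first.
  - exact/measurable_EFinP.
  - by move=> h _; rewrite lee_fin.
  apply: ge0_le_integral => //.
  - by move=> h _; rewrite mule_ge0 ?lee_fin.
  - by apply: measurable_funeM; exact/measurable_EFinP.
  - by apply: emeasurable_funD; exact: measurable_funeM.
  move=> h _; rewrite /F1 /F2 -!EFinM -EFinD lee_fin /=.
  apply: (@le_trans _ _ ((6 / 5 * g (x + h)%R + C * `|f (x + h)%R - f x| `^ p) * k x h))%R.
    by apply: ler_wpM2r => //; exact: HC.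
  rewrite mulrDl -[X in (X + _)%R]mulrA lerD2l.
  rewrite -[leRHS]mulrA -[leLHS]mulrA ler_wpM2l ?(ltW C0)//.
  by rewrite mulrCA ler_wpM2l ?powR_ge0.
have -> : S = \int[mu]_x \int[mu]_h F2 (x, h).
  rewrite fubini_tonelli//; apply: eq_integral => h _.
  have dv0 x : 0 <= (`|f (x + h)%R - f x| `^ p)%:E by rewrite lee_fin powR_ge0.
  rewrite muleC -ge0_integralZl ?lee_fin//; last first.
  - by apply/measurable_EFinP; exact: (measurableT_comp mdf (measurable_pair2 h)).
  by apply: eq_integral => x _; rewrite muleC.
(* Substituting y = x + h turns the left side into the integral of [g y] against the mass landing at
   y. *)
have step2 : \int[mu]_x \int[mu]_h F1 (x, h) <= (5 / 8)%:E * I0 + B%:E * G.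
  rewrite fubini_tonelli//.
  pose F3 (z : V * V) := (g z.1 * k (z.1 - z.2) z.2)%:E.
  have mk3 : measurable_fun setT (fun z : V * V => k (z.1 - z.2)%R z.2).
    have mp : measurable_fun setT (fun z : V * V => ((z.1 - z.2)%R, z.2)).
      by apply: measurable_fun_pair => //; exact: measurable_subrV.
    exact: (measurableT_comp mk mp).
  have mF3 : measurable_fun setT F3.
    by apply/measurable_EFinP; apply: measurable_funM => //; exact: (measurableT_comp mg measurable_fst).
  rewrite [leLHS](_ : _ = \int[mu]_h \int[mu]_y F3 (y, h)); last first.
    apply: eq_integral => h _.
    have mF1h : measurable_fun setT (fun x => F1 (x, h)).
      exact: (measurableT_comp mF1 (measurable_pair2 h)).
    transitivity (\int[mu]_x F1 ((x - h)%R, h)).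
      exact/esym/(ge0_integral_shift (- h)%R mF1h (fun x => F10 (x, h))).
    by apply: eq_integral => x _; rewrite /F1/= subrK.
  rewrite -fubini_tonelli//; last by move=> z; rewrite lee_fin mulr_ge0.
  have c1 : (0 <= 5 / 8 :> R)%R by lra.
  rewrite /I0 /G -ge0_integral_lincomb//; last 2 first.
  - exact: emeasurable_funM.
  - by move=> x; rewrite mule_ge0 ?lee_fin.
  apply: ge0_le_integral => //.
  - by move=> x _; apply: integral_ge0 => h _; rewrite lee_fin mulr_ge0.
  - by apply: (measurable_integral_snd mF3) => z; rewrite lee_fin mulr_ge0.
  - by apply: emeasurable_funD; apply: measurable_funeM => //; exact: emeasurable_funM.
  move=> y _; rewrite /F3/=.
  under eq_integral do rewrite EFinM.
  have k3E h : 0 <= (k (y - h)%R h)%:E by rewrite lee_fin.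
  rewrite ge0_integralZl ?lee_fin//; last first.
    by apply/measurable_EFinP; exact: (measurableT_comp mk3 (measurable_pair1 y)).
  apply: (@le_trans _ _ ((g y)%:E * ((5 / 8)%:E * w y + B%:E))).
    by rewrite lee_wpmul2l ?lee_fin// kB.
  have p1 : 0 <= (5 / 8)%:E * w y by rewrite mule_ge0 ?lee_fin.
  have p2 : 0 <= B%:E by rewrite lee_fin.
  rewrite (ge0_muleDr _ p1 p2).
  by rewrite muleCA; apply: leeD => //; rewrite muleC.
have S0 : 0 <= \int[mu]_x \int[mu]_h F2 (x, h).
  by apply: integral_ge0 => x _; apply: integral_ge0.
have G_fin : G \is a fin_num by rewrite ge0_fin_numE// integral_ge0// => x _; rewrite lee_fin.
move: S0 step1 step2; set J := \int[mu]_x \int[mu]_h F1 (x, h).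
set T := \int[mu]_x \int[mu]_h F2 (x, h) => T0 step1 step2.
have G0 : 0 <= G by apply: integral_ge0 => x _; rewrite lee_fin.
have {step1} : I0 <= (6 / 5)%:E * ((5 / 8)%:E * I0 + B%:E * G) + (C * K)%:E * T.
  by apply: (le_trans step1); rewrite leeD2r// lee_wpmul2l ?lee_fin//; lra.
move: T0; case: T => [T| |] T0.
- rewrite -(fineK I0_fin) -(fineK G_fin) ; do ?[rewrite -EFinM | rewrite -EFinD]; rewrite !lee_fin.
  have G0' : (0 <= fine G)%R by exact: fine_ge0.
  rewrite lee_fin in T0.
  have BG := mulr_ge0 B0 G0'; have KT := mulr_ge0 K0 T0.
  have CKT := mulr_ge0 (ltW C0) KT; have CBG := mulr_ge0 (ltW C0) BG.
  by move=> ?; nra.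
(* With an infinite difference integral, K = 0 makes its term zero and the finite argument applies;
   otherwise the right side is infinite. *)
- have [->|Kn0] := eqVneq K 0%R.
    rewrite !mulr0 !mul0e adde0 add0e -(fineK I0_fin) -(fineK G_fin) ; do ?[rewrite -EFinM | rewrite -EFinD]; rewrite !lee_fin.
    have G0' : (0 <= fine G)%R by exact: fine_ge0.
    have BG := mulr_ge0 B0 G0'; have CBG := mulr_ge0 (ltW C0) BG.
    by move=> ?; nra.
  have K0' : (0 < K)%R by rewrite lt_def Kn0.
  move=> _; rewrite gt0_muley; last by rewrite lte_fin mulr_gt0//; lra.
  by rewrite addye ?leey// -ltNye (lt_le_trans (ltNyr 0%R))// mule_ge0 ?lee_fin ?mulr_ge0//; lra.
- by rewrite leeNy_eq in T0.
Qed.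

End absorption.

(** * Integrals over balls and dyadic shells *)

Section balls.
Context {R : realType} {d : nat}.
Local Open Scope ereal_scope.
Local Notation mu := (lebesgue_rV R d).
Local Notation V := 'rV[R]_d.

Lemma le_ge0_integral (F G : V -> \bar R) :
  measurable_fun setT F -> measurable_fun setT G ->
  (forall x, 0 <= F x) -> (forall x, F x <= G x) ->
  \int[mu]_x F x <= \int[mu]_x G x.
Proof. by move=> mF mG F0 FG; apply: ge0_le_integral. Qed.

Lemma ge0_integralZ (a : R) (F : V -> \bar R) : (0 <= a)%R ->
  measurable_fun setT F -> (forall x, 0 <= F x) ->
  \int[mu]_x (a%:E * F x) = a%:E * \int[mu]_x F x.
Proof. by move=> a0 mF F0; rewrite ge0_integralZl. Qed.

Lemma measurable_enorm_bool (r : R) :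
  [/\ measurable_fun setT (fun x : V => (r < enorm x)%R),
      measurable_fun setT (fun x : V => (enorm x < r)%R) &
      measurable_fun setT (fun x : V => (enorm x <= r)%R)].
Proof.
split; [apply: measurable_fun_ltr|apply: measurable_fun_ltr|apply: measurable_fun_ler] => //;
  exact: measurable_enorm.
Qed.

Context (v0 : R).
Context (ballE : forall r : R, (0 < r)%R ->
  \int[mu]_x ((enorm x <= r)%R%:R)%:E = (v0 * r ^+ d)%:E).

Lemma integral_ball (c r : R) : (0 <= c)%R -> (0 < r)%R ->
  \int[mu]_x (c * (enorm x <= r)%R%:R)%:E = (c * (v0 * r ^+ d))%:E.
Proof.
move=> c0 r0; under eq_integral do rewrite EFinM.
rewrite ge0_integralZ//; first by rewrite ballE.
by apply/measurable_EFinP; apply: measurable_natr_bool; case: (measurable_enorm_bool r).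
Qed.

Lemma measurable_shell (r s : R) :
  measurable_fun setT (fun x : V => (r < enorm x)%R && (enorm x <= s)%R).
Proof.
have [m1 _ _] := measurable_enorm_bool r; have [_ _ m2] := measurable_enorm_bool s.
exact: measurable_and.
Qed.

(** The ball of radius 2r is the shell plus the ball of radius r. Working with the sum avoids a
    subtraction of extended reals. *)
Lemma integral_shell (c r : R) : (0 <= c)%R -> (0 < r)%R ->
  \int[mu]_x (c * ((r < enorm x) && (enorm x <= 2 * r))%:R)%:E =
  (c * (v0 * (2 ^+ d - 1) * r ^+ d))%:E.
Proof.
move=> c0 r0; have [_ _ m1] := measurable_enorm_bool r.
have m2 := measurable_shell r (2 * r).
have m1' := measurable_natr_bool m1 (R := R).
have m2' := measurable_natr_bool m2 (R := R).
have : \int[mu]_x (c * ((r < enorm x) && (enorm x <= 2 * r))%:R)%:E +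
    \int[mu]_x (c * (enorm x <= r)%R%:R)%:E = (c * (v0 * (2 * r) ^+ d))%:E.
  rewrite -ge0_integralD//.
  - rewrite -integral_ball//; last by lra.
    apply: eq_integral => x _; rewrite -EFinD -mulrDr; congr (_ * _)%:E.
    case: (ltP r (enorm x)) => h1; first by rewrite addr0.
    by rewrite add0r (_ : (enorm x <= 2 * r)%R = true)//; lra.
  - by move=> x _; rewrite lee_fin mulr_ge0.
  - by apply/measurable_EFinP; exact: measurable_funM.
  - by move=> x _; rewrite lee_fin mulr_ge0.
  - by apply/measurable_EFinP; exact: measurable_funM.
rewrite integral_ball//.
set X := \int[mu]_x _; case: X => // X; rewrite -EFinD => -[E].
by congr EFin; rewrite exprMn in E; lra.
Qed.

End balls.

Lemma lee_half (R : realType) (x y : \bar R) :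
  (0 <= x -> x + x <= y -> x <= 2^-1%:E * y)%E.
Proof.
have h0 : (0 < 2^-1 :> R) by rewrite invr_gt0.
case: x => [x| |]//; case: y => [y| |]//=.
- by rewrite -EFinD -EFinM !lee_fin; lra.
- by rewrite gt0_muley ?leey// lte_fin.
- by rewrite gt0_muley// lte_fin.
Qed.

(** * Tails of [nu] and the half-space estimate *)

Section jump_kernel.
Context {R : realType} {d : nat}.
Local Open Scope ereal_scope.
Local Notation mu := (lebesgue_rV R d).
Local Notation V := 'rV[R]_d.
Implicit Types (x y z h : V).

Context (v0 : R) (v0_gt0 : (0 < v0)%R).
Context (ballE : forall r : R, (0 < r)%R ->
  \int[mu]_x ((enorm x <= r)%R%:R)%:E = (v0 * r ^+ d)%:E).
Context (nu : R -> R) (nu_ge0 : forall r, (0 <= nu r)%R).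
Context (mnu : measurable_fun setT (fun x => nu (enorm x))).
Context (C0 b R0 : R) (C0_gt0 : (0 < C0)%R) (b_gt0 : (0 < b)%R).
Context (nu_scal : forall s r : R, (0 < s)%R -> (s <= r)%R -> (r < R0)%R ->
  (nu s <= C0 * (r / s) `^ b * nu r)%R).

(** Where r/s is bounded by c, the scaling hypothesis becomes almost monotonicity with a constant
    factor, the form used in the estimates below. *)
Lemma nu_ratio (c s r : R) : (0 < s)%R -> (s <= r)%R -> (r < R0)%R ->
  (r <= c * s)%R -> (nu s <= C0 * c `^ b * nu r)%R.
Proof.
move=> s0 sr rR rc; apply: (le_trans (nu_scal s0 sr rR)).
apply: ler_wpM2r => //; apply: ler_wpM2l; first exact: ltW.
apply: powR_le; first exact: ltW.
  by rewrite divr_ge0//; lra.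
by rewrite ler_pdivrMr.
Qed.

Definition tail (t : R) : \bar R := \int[mu]_h (nu (enorm h) * (t < enorm h)%R%:R)%:E.

Lemma measurable_nu_bool (B : V -> bool) : measurable_fun setT B ->
  measurable_fun setT (fun h => (nu (enorm h) * (B h)%:R)%:E).
Proof.
move=> mB; apply/measurable_EFinP; apply: measurable_funM => //.
exact: measurable_natr_bool.
Qed.

Lemma nu_bool_ge0 (c : bool) h : 0 <= (nu (enorm h) * c%:R)%:E.
Proof. by rewrite lee_fin mulr_ge0. Qed.

Lemma le_integral_nu_bool (A B : V -> bool) :
  measurable_fun setT A -> measurable_fun setT B -> (forall h, A h -> B h) ->
  \int[mu]_h (nu (enorm h) * (A h)%:R)%:E <= \int[mu]_h (nu (enorm h) * (B h)%:R)%:E.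
Proof.
move=> mA mB AB; apply: le_ge0_integral => [||h|h].
- exact: measurable_nu_bool.
- exact: measurable_nu_bool.
- exact: nu_bool_ge0.
- by rewrite lee_fin ler_wpM2l// ler_nat; case: (A h) (AB h) => [/(_ isT) ->|].
Qed.

Let mlt (t : R) : measurable_fun setT (fun h => (t < enorm h)%R).
Proof. by case: (@measurable_enorm_bool R d t). Qed.

Let mle (t : R) : measurable_fun setT (fun h => (enorm h <= t)%R).
Proof. by case: (@measurable_enorm_bool R d t). Qed.

Lemma tail_ge0 t : 0 <= tail t.
Proof. by apply: integral_ge0 => h _; exact: nu_bool_ge0. Qed.

Lemma tail_anti (s t : R) : (s <= t)%R -> tail t <= tail s.
Proof. by move=> st; apply: le_integral_nu_bool => // h; exact: (le_lt_trans st). Qed.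

Lemma measurable_landing (t : R) y :
  measurable_fun setT (fun h => (Num.max (enorm (y - h)) t < enorm h)%R).
Proof.
apply: measurable_fun_ltr; last exact: measurable_enorm.
apply: measurable_maxr => //; apply: (measurableT_comp measurable_enorm).
by apply: measurable_fun_rV => i; under eq_fun do rewrite !mxE; apply: measurable_funB => //;
  exact: measurable_coord.
Qed.

(* The set where [|y - h| < |h|] is a half-space not meeting its reflection
   through the origin. *)
Lemma half_tail (t : R) y :
  \int[mu]_h (nu (enorm h) * (Num.max (enorm (y - h)) t < enorm h)%R%:R)%:E
  <= 2^-1%:E * tail (Num.max (enorm y / 2) t)%R.
Proof.
set P := fun h => (Num.max (enorm (y - h)) t < enorm h)%R.
have mP : measurable_fun setT P by exact: measurable_landing.
have mN : measurable_fun [set: V] (fun h => (- h)%R).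
  by apply: measurable_fun_rV => i; under eq_fun do rewrite !mxE; apply: measurable_funN;
    exact: measurable_coord.
have mPN : measurable_fun setT (fun h => P (- h)%R) by exact: (measurableT_comp mP mN).
set X := \int[mu]_h _.
have X0 : 0 <= X by apply: integral_ge0 => h _; exact: nu_bool_ge0.
have XN : \int[mu]_h (nu (enorm h) * (P (- h)%R)%:R)%:E = X.
  rewrite /X -[RHS]ge0_integral_opp.
  - by apply: eq_integral => h _; congr (nu _ * _)%:E; rewrite enormN.
  - exact: measurable_nu_bool.
  - by move=> h; exact: nu_bool_ge0.
(* [P] and its reflection are disjoint, and on either of them |h| > |y|/2 by the triangle
   inequality, so two copies of X fit into one tail. *)
have : X + X <= tail (Num.max (enorm y / 2) t)%R.
  rewrite -{2}XN -ge0_integralD//; [|by move=> h _; exact: nu_bool_ge0|exact: measurable_nu_bool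
    |by move=> h _; exact: nu_bool_ge0|exact: measurable_nu_bool].
  apply: le_ge0_integral => [||h|h].
  - by apply: emeasurable_funD; exact: measurable_nu_bool.
  - exact: measurable_nu_bool.
  - by rewrite adde_ge0// nu_bool_ge0.
  rewrite -EFinD lee_fin -mulrDr ler_wpM2l// -natrD ler_nat /P.
  rewrite !gt_max opprK.
  have T1 := ler_enormD (y - h) h; rewrite subrK in T1.
  have T2 := ler_enormD (y + h) (- h); rewrite addrK !enormN in T2.
  have e0 := enorm_ge0 y.
  have := enorm_parallelogram y h; have [d1 d2 d3] := And3 (enorm_ge0 h) (enorm_ge0 (y - h)) (enorm_ge0 (y + h)).
  rewrite !expr2 enormN => PL.
  case: (ltP (enorm (y - h)) (enorm h)) => h1; case: (ltP (enorm (y + h)) (enorm h)) => h2 //=.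
  (* Both inequalities would give |y - h|^2 + |y + h|^2 < 2|h|^2, against the parallelogram law. *)
  - by exfalso; clear X0 XN; nra.
  - rewrite addn0; case: (t < enorm h)%R => //=; rewrite andbT.
    by rewrite (_ : (enorm y / 2 < enorm h)%R = true)//; clear X0 XN; lra.
  - rewrite add0n; case: (t < enorm h)%R => //=; rewrite andbT.
    by rewrite (_ : (enorm y / 2 < enorm h)%R = true)//; clear X0 XN; lra.
exact: lee_half.
Qed.

(** * The truncated jump kernel: its weight and its landing mass *)

Section truncated.
Context (t e M L : R) (t_gt0 : (0 < t)%R) (te : (t < e)%R) (M2 : (2 <= M)%R).
Context (eR : ((2 * M + 1) * e < R0)%R) (L0 : (0 <= L)%R).

Ltac slra := move: (t_gt0) (te) (M2) (eR) => ? ? ? ?; lra.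
Ltac snra := move: (t_gt0) (te) (M2) (eR) => ? ? ? ?; nra.

Let near0 x := ((t < enorm x) && (enorm x < e))%R.

(** The density is frozen at the starting point, which makes the weight an exact multiple of
    [core x]. Jump sizes stay below 2Me < R0, where scaling is available. *)
Definition far_jump x h : R := (L * (nu (enorm x) * (near0 x)%:R) *
  ((M * enorm x < enorm h) && (enorm h <= 2 * (M * enorm x)))%:R)%R.

(** Truncating by a maximum gives the first summand the weight [tail t], not zero, when |x| <= t. *)
Definition jump x h : R :=
  (nu (enorm h) * (Num.max (enorm x) t < enorm h)%R%:R + far_jump x h)%R.

Definition core x : R := (nu (enorm x) * enorm x ^+ d * (near0 x)%:R)%R.

Lemma core_ge0 x : (0 <= core x)%R.
Proof. by rewrite !mulr_ge0// exprn_ge0// enorm_ge0. Qed.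

Lemma far_jump_ge0 x h : (0 <= far_jump x h)%R.
Proof. by rewrite !mulr_ge0. Qed.

Lemma jump_ge0 x h : (0 <= jump x h)%R.
Proof. by rewrite addr_ge0 ?mulr_ge0 ?far_jump_ge0. Qed.

Lemma measurable_far_jump : measurable_fun setT (fun z : V * V => far_jump z.1 z.2).
Proof.
have me1 : measurable_fun setT (fun z : V * V => enorm z.1).
  exact: (measurableT_comp measurable_enorm measurable_fst).
have me2 : measurable_fun setT (fun z : V * V => enorm z.2).
  exact: (measurableT_comp measurable_enorm measurable_snd).
have mn1 : measurable_fun setT (fun z : V * V => nu (enorm z.1)).
  exact: (measurableT_comp mnu measurable_fst).
apply: measurable_funM; first apply: measurable_funM => //; first apply: measurable_funM => //.
  by apply: measurable_natr_bool; apply: measurable_and; exact: measurable_fun_ltr.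
have mM : measurable_fun setT (fun z : V * V => M * enorm z.1)%R by exact: measurable_funM.
apply: measurable_natr_bool; apply: measurable_and; first exact: measurable_fun_ltr.
by apply: measurable_fun_ler => //; exact: measurable_funM.
Qed.

Lemma measurable_jump : measurable_fun setT (fun z : V * V => jump z.1 z.2).
Proof.
have me1 : measurable_fun setT (fun z : V * V => enorm z.1).
  exact: (measurableT_comp measurable_enorm measurable_fst).
have me2 : measurable_fun setT (fun z : V * V => enorm z.2).
  exact: (measurableT_comp measurable_enorm measurable_snd).
have mn2 : measurable_fun setT (fun z : V * V => nu (enorm z.2)).
  exact: (measurableT_comp mnu measurable_snd).
apply: measurable_funD; last exact: measurable_far_jump.
apply: measurable_funM => //; apply: measurable_natr_bool.
by apply: measurable_fun_ltr => //; exact: measurable_maxr.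
Qed.

(** A far jump satisfies |x| <= |h| <= 2M|x| < R0, so nu(|x|) <= C0 (2M)^b nu(|h|). The resulting
    constant is free of [t]. *)
Lemma jump_le x h : (jump x h <= (1 + L * (C0 * (2 * M) `^ b)) * nu (enorm h))%R.
Proof.
rewrite mulrDl mul1r lerD//.
  by rewrite -[leRHS]mulr1 ler_wpM2l// lern1 leq_b1.
have K0 : (0 <= L * (C0 * (2 * M) `^ b) * nu (enorm h))%R.
  by rewrite !mulr_ge0// ?powR_ge0 ?(ltW C0_gt0).
rewrite /far_jump; case: (boolP (near0 x)) => [/andP[x1 x2]|_]; last by rewrite !(mulr0, mul0r).
case: andP => [[h1 h2]|_]; last by rewrite mulr0.
rewrite !mulr1 -mulrA ler_wpM2l//; have x0 : (0 < enorm x)%R by slra.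
have Mx : (M * enorm x <= M * e)%R by rewrite ler_wpM2l//; slra.
have Mx2 : (2 * enorm x <= M * enorm x)%R by rewrite ler_wpM2r// ltW.
by apply: nu_ratio => //; slra.
Qed.

Let jump_weight := (v0 * (2 ^+ d - 1) * M ^+ d)%R.

Lemma integral_jump x :
  \int[mu]_h (jump x h)%:E = tail (Num.max (enorm x) t) + (L * jump_weight * core x)%:E.
Proof.
rewrite /jump; under eq_integral do rewrite EFinD.
rewrite ge0_integralD//; last 4 first.
- by move=> h _; exact: nu_bool_ge0.
- exact: measurable_nu_bool.
- by move=> h _; rewrite lee_fin far_jump_ge0.
- by apply/measurable_EFinP; exact: (measurableT_comp measurable_far_jump (measurable_pair1 x)).
congr (_ + _); rewrite /core /far_jump; case E : (near0 x); last first.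
  by rewrite !(mulr0, mul0r); under eq_integral do rewrite mul0r; rewrite integral0.
have x0 : (0 < enorm x)%R by move: E => /andP[? _]; slra.
rewrite (integral_shell ballE)//.
- by congr EFin; rewrite exprMn /jump_weight; ring.
- by rewrite !mulr_ge0.
- by rewrite mulr_gt0//; slra.
Qed.

(** Almost monotonicity between |x| and e, whose ratio is at most e/t. The dependence on [t] is
    harmless: the bound serves only to ensure finiteness before absorption. *)
Lemma core_le x : (core x <= C0 * (e / t) `^ b * nu e * e ^+ d)%R.
Proof.
rewrite /core /near0; case: andP => [[x1 x2]|_]; last first.
  by rewrite mulr0 !mulr_ge0// ?powR_ge0 ?exprn_ge0 ?(ltW C0_gt0)//; slra.
have x0 := enorm_ge0 x; rewrite mulr1 ler_pM ?exprn_ge0//; last first.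
  by rewrite lerXn2r ?nnegrE//; slra.
apply: nu_ratio; [slra|exact: ltW|snra|].
by rewrite mulrAC ler_pdivlMr//; snra.
Qed.

(** For |y| <= t both maxima are t, and for |y| >= e the tail at e/2 suffices. In between, the
    additional h satisfy |y|/2 < |h| <= |y|, hence nu(|h|) <= C0 2^b nu(|y|), and they lie in a ball
    of volume v0 |y|^d. *)
Lemma tail_half_le y : tail (Num.max (enorm y / 2) t)%R <=
  tail (Num.max (enorm y) t) + (C0 * 2 `^ b * v0 * core y)%:E + tail (e / 2)%R.
Proof.
have Cb : (0 <= C0 * 2 `^ b)%R by rewrite mulr_ge0 ?powR_ge0// ltW.
have c0 : (0 <= C0 * 2 `^ b * v0 * core y)%R.
  by rewrite mulr_ge0 ?core_ge0// mulr_ge0// ltW.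
have y0 := enorm_ge0 y.
have [yt|yt] := leP (enorm y) t.
  rewrite !max_r//; last by slra.
  by rewrite -addeA leeDl// adde_ge0 ?lee_fin ?tail_ge0.
have [ye|ye] := ltP (enorm y) e; last first.
  apply: (@le_trans _ _ (tail (e / 2)%R)).
    by apply: tail_anti; rewrite le_max; apply/orP; left; slra.
  by rewrite leeDr// adde_ge0 ?lee_fin ?tail_ge0.
apply: (@le_trans _ _ (tail (enorm y) + (C0 * 2 `^ b * v0 * core y)%:E)); last first.
  by apply: leeDl; exact: tail_ge0.
rewrite /core /near0 yt ye/= mulr1.
rewrite [X in _ + X](_ : _ = (C0 * 2 `^ b * nu (enorm y) * (v0 * enorm y ^+ d))%:E); last first.
  by congr EFin; ring.
have nn : (0 <= C0 * 2 `^ b * nu (enorm y))%R by rewrite mulr_ge0.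
have mB : measurable_fun setT (fun h => (C0 * 2 `^ b * nu (enorm y) * (enorm h <= enorm y)%R%:R)%:E).
  by apply/measurable_EFinP; apply: measurable_funM => //; exact: measurable_natr_bool.
rewrite -(integral_ball ballE)//; last by slra.
rewrite -ge0_integralD//; last 3 first.
- by move=> h _; exact: nu_bool_ge0.
- exact: measurable_nu_bool.
- by move=> h _; rewrite lee_fin mulr_ge0.
apply: le_ge0_integral => [||h|h].
- exact: measurable_nu_bool.
- by apply: emeasurable_funD => //; exact: measurable_nu_bool.
- exact: nu_bool_ge0.
rewrite -EFinD lee_fin; case: (ltP (enorm y) (enorm h)) => h1.
  by rewrite mulr1 mulr0 addr0 -[leRHS]mulr1 ler_wpM2l// lern1 leq_b1.
rewrite mulr0 add0r mulr1; case: ltP => h2; last by rewrite mulr0.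
move: h2; rewrite gt_max => /andP[h2 h3]; rewrite mulr1.
by apply: nu_ratio => //; [slra|snra|slra].
Qed.

Let ratio := (C0 * (2 * M + 1) `^ b)%R.
Let ratio_ge0 : (0 <= ratio)%R. Proof. by rewrite mulr_ge0 ?powR_ge0// ltW. Qed.
Let r1 := ((2 * M + 1) * e)%R.

(** For the starting point z = y - h, a far jump forces (M - 1)|z| < |y| <= (2M + 1)|z|. So z lies
    in a ball of volume v0 (|y|/(M - 1))^d, which is the gain, and nu(|z|) <= [ratio] nu(|y|).
    Landing points can lie beyond e but stay within [r1], whence the second term. *)
Lemma integral_landing y :
  \int[mu]_h (far_jump (y - h) h)%R%:E <=
  (L * ratio * v0 / (M - 1) ^+ d * (core y + ratio * nu r1 * r1 ^+ d))%:E.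
Proof.
have e0 : (0 < e)%R by slra.
have r1e : (e <= r1)%R by rewrite /r1; snra.
have M1 : (0 < M - 1)%R by slra.
have last0 : (0 <= ratio * nu r1 * r1 ^+ d)%R.
  by apply: mulr_ge0; [exact: mulr_ge0|apply: exprn_ge0; slra].
have q0 : (0 <= L * ratio * v0 / (M - 1) ^+ d)%R.
  by rewrite divr_ge0 ?exprn_ge0 ?(ltW M1)// mulr_ge0 ?(ltW v0_gt0)// mulr_ge0.
pose F z := (L * (nu (enorm z) * (near0 z)%:R) *
    ((M * enorm z < enorm (y - z)) && (enorm (y - z) <= 2 * (M * enorm z)))%:R)%R.
have F0 z : 0 <= (F z)%:E by rewrite lee_fin !mulr_ge0.
have myz : measurable_fun setT (fun z => enorm (y - z)).
  apply: (measurableT_comp measurable_enorm).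
  by apply: measurable_fun_rV => i; under eq_fun do rewrite !mxE; apply: measurable_funB => //;
    exact: measurable_coord.
have mz : measurable_fun setT (@enorm R d) by exact: measurable_enorm.
have mF : measurable_fun setT (fun z => (F z)%:E).
  apply/measurable_EFinP; apply: measurable_funM; first apply: measurable_funM => //;
    first apply: measurable_funM => //.
    by apply: measurable_natr_bool; apply: measurable_and; exact: measurable_fun_ltr.
  have mM : measurable_fun setT (fun z : V => M * enorm z)%R by exact: measurable_funM.
  apply: measurable_natr_bool; apply: measurable_and; first exact: measurable_fun_ltr.
  by apply: measurable_fun_ler => //; exact: measurable_funM.
rewrite [leLHS](_ : _ = \int[mu]_z (F z)%:E); last first.
  have t0 : (-1 != 0 :> R)%R by rewrite oppr_eq0 oner_neq0.
  rewrite -[RHS](ge0_integral_affine_rV y t0 mF F0) normrN1 expr1n mul1e.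
  apply: eq_integral => h _; rewrite scaleN1r /F.
  by rewrite (addrC (- h)%R) opprB addrCA subrr addr0.
(* At y = 0 a jump would need M|z| < |z|. The case is separate because [integral_ball] asks for a
   positive radius. *)
have [y0|y0] := eqVneq (enorm y) 0%R.
  rewrite [leLHS](_ : _ = 0); last first.
    apply: integral0_eq => z _; rewrite /F; congr EFin.
    case: (boolP (near0 z)) => [/andP[z1 z2]|_]; last by rewrite !(mulr0, mul0r).
    move/eqP : y0; rewrite enorm_eq0 => /eqP ->; rewrite sub0r enormN.
    case: andP => [[z3 z4]|_]; last by rewrite !(mulr0, mul0r).
    by snra.
  by rewrite lee_fin mulr_ge0// addr_ge0 ?core_ge0.
have {}y0 : (0 < enorm y)%R by rewrite lt_def y0 enorm_ge0.
pose near0' := ((t < enorm y) && (enorm y < r1))%R.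
pose c := (L * ratio * (nu (enorm y) * near0'%:R))%R.
have c0 : (0 <= c)%R by apply: mulr_ge0; exact: mulr_ge0.
apply: (@le_trans _ _ (\int[mu]_z (c * (enorm z <= enorm y / (M - 1))%R%:R)%:E)).
  apply: le_ge0_integral => // [|z].
    by apply/measurable_EFinP; apply: measurable_funM => //; exact: measurable_natr_bool.
  rewrite lee_fin /F; case: (boolP (near0 z)) => [/andP[z1 z2]|_]; last by rewrite !(mulr0, mul0r) mulr_ge0.
  case: andP => [[z3 z4]|_]; last by rewrite mulr0 mulr_ge0.
  have T1 := ler_enormD (y - z) z; rewrite subrK in T1.
  have T2 := ler_enormD y (- z); rewrite enormN in T2.
  have zM : (enorm z <= enorm y / (M - 1))%R by rewrite ler_pdivlMr//; slra.
  have zy : (enorm z <= enorm y)%R by snra.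
  have yr : (enorm y <= (2 * M + 1) * enorm z)%R by slra.
  have yr1 : (enorm y < r1)%R by rewrite /r1; snra.
  rewrite zM /c /near0' yr1 (_ : (t < enorm y)%R = true) /=; last by slra.
  rewrite !mulr1 -mulrA ler_wpM2l//.
  by apply: nu_ratio => //; [slra|rewrite /r1 in yr1; slra].
rewrite (integral_ball ballE) ?divr_gt0// lee_fin /c.
rewrite [leLHS](_ : _ = L * ratio * v0 / (M - 1) ^+ d * (nu (enorm y) * enorm y ^+ d * near0'%:R))%R; last first.
  by rewrite expr_div_n; ring.
rewrite ler_wpM2l//.
rewrite /near0'; case: andP => [[y1 y2]|_]; last by rewrite mulr0 addr_ge0 ?core_ge0.
(* For e <= |y| < r1 the term [core y] is zero; almost monotonicity between |y| and r1 gives a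
   constant bound instead. *)
have [ye|ye] := ltP (enorm y) e.
  by rewrite /core /near0 y1 ye/= mulr1 lerDl.
apply: (@le_trans _ _ (ratio * nu r1 * r1 ^+ d)%R); last by rewrite lerDr core_ge0.
rewrite mulr1 ler_pM ?exprn_ge0//; first exact: ltW.
  apply: nu_ratio => //; first exact: ltW.
  by rewrite /r1 ler_wpM2l//; slra.
by rewrite lerXn2r ?nnegrE//; slra.
Qed.

(** The tail at |y| returns with factor 1/2. The coefficient of [core y] collects half the loss of
    [tail_half_le] and the far landing mass; the numerical hypothesis keeps it below 5/8 of the
    outgoing one. What remains is a bound uniform in [t]. *)
Lemma jump_landing (T : R) y : tail (e / 2)%R <= T%:E ->
  (2^-1 * (C0 * 2 `^ b * v0) + L * ratio * v0 / (M - 1) ^+ d <= 5 / 8 * (L * jump_weight))%R ->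
  \int[mu]_h (jump (y - h) h)%R%:E <= (5 / 8)%:E * \int[mu]_h (jump y h)%:E +
    (2^-1 * T + L * ratio * v0 / (M - 1) ^+ d * (ratio * nu r1 * r1 ^+ d))%:E.
Proof.
move=> tT HL; rewrite /jump; under eq_integral do rewrite EFinD.
rewrite ge0_integralD//; last 4 first.
- by move=> h _; exact: nu_bool_ge0.
- by apply: measurable_nu_bool; exact: measurable_landing.
- by move=> h _; rewrite lee_fin far_jump_ge0.
- have mp : measurable_fun setT (fun h : V => ((y - h)%R, h)).
    apply: measurable_fun_pair => //; apply: measurable_fun_rV => i.
    by under eq_fun do rewrite !mxE; apply: measurable_funB => //; exact: measurable_coord.
  by apply/measurable_EFinP; exact: (measurableT_comp measurable_far_jump mp).
have -> := integral_jump y.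
apply: (le_trans (leeD (half_tail t y) (integral_landing y))).
have := tail_half_le y; move: tT.
have := tail_ge0 (e / 2)%R; have := tail_ge0 (Num.max (enorm y) t).
set X := tail (Num.max (enorm y / 2) t)%R; set Y := tail (Num.max (enorm y) t).
set Z := tail (e / 2)%R; set c := (L * ratio * v0 / _)%R in HL *.
have := ler_wpM2r (core_ge0 y) HL; rewrite mulrDl => HL'.
(* An infinite tail at |y| makes the right side infinite. *)
case: Z => // Z; case: Y => [Y| |]// Y0 Z0 ZT; last first.
  by move=> _; rewrite addye// gt0_muley ?addye ?leey// lte_fin; slra.
case: X => [X| |] //; do ?[rewrite -EFinM | rewrite -EFinD]; rewrite ?lee_fin.
  move=> H; rewrite !lee_fin in ZT Y0.
  rewrite (mulrDr c); slra.
by move=> _; rewrite gt0_muleNy ?lte_fin ?addNye ?leNye//; slra.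
Qed.

End truncated.
End jump_kernel.

(** * Choice of the dilation factor [M] *)

Section exponents.
Context {R : realType}.
Implicit Types (C b q : R).

(** It suffices that M^(q - b) >= C; the maximum with 0 allows C of any sign. *)
Lemma powR_large C b q : b < q -> exists M : R, 2 <= M /\ C * M `^ b <= M `^ q.
Proof.
move=> bq; have e0 : 0 < q - b by lra.
pose Q := Num.max C 0; pose M := Num.max 2 (Q `^ (q - b)^-1).
have M2 : 2 <= M by rewrite le_max lexx.
have M0 : M != 0 by lra.
exists M; split => //; have -> : q = (q - b) + b by ring.
rewrite powRD; last by rewrite M0 implybT.
apply: ler_wpM2r; first exact: powR_ge0.
have Q0 : 0 <= Q by rewrite le_max lexx orbT.
apply: (@le_trans _ _ Q); first by rewrite le_max lexx.
rewrite -[leLHS](powRr1 Q0) -(mulVf (lt0r_neq0 e0)) powRrM.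
by apply: powR_le; rewrite ?powR_ge0 ?(ltW e0)// le_max lexx orbT.
Qed.

(** By 2M + 1 <= 3M and M <= 2(M - 1), the claim compares M^b with M^(2d). The factor 1/8 is the gap
    between 1/2 and 5/8. *)
Lemma landing_factor (d : nat) C b : 0 < C -> 0 < b -> b < d%:R + d%:R ->
  exists M : R, 2 <= M /\ C * (2 * M + 1) `^ b <= 8^-1 * (M ^+ d * (M - 1) ^+ d).
Proof.
move=> C0 b0 bd; have [M [M2 HM]] := powR_large (8 * C * 3 `^ b * 2 ^+ d) bd.
exists M; split => //; have M0 : 0 <= M by lra.
have : M `^ (d%:R + d%:R) = M ^+ d * M ^+ d.
  by rewrite powRD ?powR_mulrn//; apply/implyP => _; lra.
move=> E; rewrite E in HM.
have H1 : (2 * M + 1) `^ b <= 3 `^ b * M `^ b.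
  by rewrite -powRM//; apply: powR_le; lra.
have H2 : M ^+ d <= 2 ^+ d * (M - 1) ^+ d.
  by rewrite -exprMn lerXn2r ?nnegrE//; lra.
have p2 : 0 < 2 ^+ d :> R by rewrite exprn_gt0.
have Md : 0 <= M ^+ d by rewrite exprn_ge0.
rewrite -(ler_pM2l p2).
have := ler_wpM2l Md H2 => H3.
have := ler_wpM2l (ltW C0) H1 => /(ler_wpM2l (ltW p2)) H4.
apply: (le_trans H4); lra.
Qed.

End exponents.

(** * Bounds for [hfun] near and away from the origin *)

Section weight.
Context {R : realType} {d : nat}.
Local Open Scope ereal_scope.
Local Notation mu := (lebesgue_rV R d).
Local Notation V := 'rV[R]_d.
Implicit Types (x y z h : V).

Context (v0 : R) (v0_gt0 : (0 < v0)%R).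
Context (ballE : forall r : R, (0 < r)%R ->
  \int[mu]_x ((enorm x <= r)%R%:R)%:E = (v0 * r ^+ d)%:E).
Context (nu : R -> R) (nu_ge0 : forall r, (0 <= nu r)%R).
Context (mnu : measurable_fun setT (fun x => nu (enorm x))).
Context (C0 b R0 : R) (C0_gt0 : (0 < C0)%R) (b_gt0 : (0 < b)%R).
Context (nu_scal : forall s r : R, (0 < s)%R -> (s <= r)%R -> (r < R0)%R ->
  (nu s <= C0 * (r / s) `^ b * nu r)%R).
Context (p : R) (p_gt0 : (0 < p)%R).
Context (I0 : R)
  (nu_int : \int[mu]_x (Num.min 1 (enorm x `^ p) * nu (enorm x))%:E <= I0%:E).

Let men : measurable_fun [set: V] (@enorm R d).
Proof. exact: measurable_enorm. Qed.

Let menp : measurable_fun setT (fun x => enorm x `^ p)%R.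
Proof. exact: (measurableT_comp (measurable_powR p) men). Qed.

Let mlt (t : R) : measurable_fun setT (fun h => (t < enorm h)%R).
Proof. by case: (@measurable_enorm_bool R d t). Qed.

Let mle (t : R) : measurable_fun setT (fun h => (enorm h <= t)%R).
Proof. by case: (@measurable_enorm_bool R d t). Qed.

Let measurable_min : measurable_fun setT (fun x => (Num.min 1 (enorm x `^ p) * nu (enorm x))%:E).
Proof. by apply/measurable_EFinP; apply: measurable_funM => //; exact: measurable_minr. Qed.

Let min_ge0 x : (0 <= Num.min 1 (enorm x `^ p))%R.
Proof. by rewrite le_min ler01 powR_ge0. Qed.

Let min_nu_ge0 x : 0 <= (Num.min 1 (enorm x `^ p) * nu (enorm x))%:E.
Proof. by rewrite lee_fin mulr_ge0. Qed.

Let le_min_integral (F : V -> R) c : (0 <= c)%R ->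
  measurable_fun setT F -> (forall x, 0 <= F x)%R ->
  (forall x, F x <= c * (Num.min 1 (enorm x `^ p) * nu (enorm x)))%R ->
  \int[mu]_x (F x)%:E <= (c * I0)%:E.
Proof.
move=> c0 mF F0 FG; apply: (@le_trans _ _ (c%:E * \int[mu]_x (Num.min 1 (enorm x `^ p) * nu (enorm x))%:E)).
  rewrite -ge0_integralZ//; apply: le_ge0_integral => [||x|x].
  - exact/measurable_EFinP.
  - exact: measurable_funeM.
  - by rewrite lee_fin.
  - by rewrite -EFinM lee_fin.
by rewrite EFinM lee_wpmul2l ?lee_fin.
Qed.

Let powR_inv_ge1 (t : R) : (0 < t)%R -> (t <= 1)%R -> (1 <= (t `^ p)^-1)%R.
Proof.
move=> t0 t1; rewrite invf_ge1 ?powR_gt0//.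
have <- : ((1 : R) `^ p = 1)%R by rewrite powR1.
by apply: powR_le => //; exact: ltW.
Qed.

(** Chebyshev: min(1, |x|^p) >= t^p once |x| > t, as t <= 1. *)
Lemma tail_le (t : R) : (0 < t)%R -> (t <= 1)%R ->
  @tail R d nu t <= ((t `^ p)^-1 * I0)%:E.
Proof.
move=> t0 t1; have tp := powR_inv_ge1 t0 t1; have tp0 := powR_gt0 p t0.
apply: le_min_integral => [||x|x].
- by lra.
- by apply: measurable_funM => //; exact: measurable_natr_bool.
- by rewrite mulr_ge0.
- case: ltP => h1; last by rewrite mulr0 !mulr_ge0//; lra.
  rewrite mulr1 mulrA ler_peMl//.
  rewrite mulrC ler_pdivlMr// mul1r le_min; apply/andP; split.
    by rewrite -[leRHS]invrK invf_ge1 ?invr_gt0// invrK in tp *; lra.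
  by apply: powR_le; rewrite ?(ltW p_gt0)//; lra.
Qed.

(** For r >= e and e <= 1, min(1, |x|^p/r^p) is at most e^(-p) min(1, |x|^p). *)
Lemma hfun_far (e r : R) : (0 < e)%R -> (e <= 1)%R -> (e <= r)%R ->
  hfun (d := d) nu p r <= ((e `^ p)^-1 * I0)%:E.
Proof.
move=> e0 e1 er; have tp := powR_inv_ge1 e0 e1; have tp0 := powR_gt0 p e0.
have r0 : (0 < r)%R by lra. have rp0 := powR_gt0 p r0.
apply: le_min_integral => [||x|x].
- by lra.
- by apply: measurable_funM => //; apply: measurable_minr => //; exact: measurable_funM.
- by rewrite mulr_ge0// le_min ler01 divr_ge0 ?powR_ge0.
- rewrite mulrA ler_wpM2r// minr_pMr; last by lra.
  rewrite le_min !ge_min; apply/andP; split; first by apply/orP; left; lra.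
  apply/orP; right; rewrite mulrC ler_wpM2r ?powR_ge0// lef_pV2 ?posrE//.
  by apply: powR_le; rewrite ?(ltW p_gt0)//; lra.
Qed.

Definition moment (r : R) : \bar R :=
  \int[mu]_h (enorm h `^ p * nu (enorm h) * (enorm h <= r)%R%:R)%:E.

Let moment_integrand_ge0 r h : 0 <= (enorm h `^ p * nu (enorm h) * (enorm h <= r)%R%:R)%:E.
Proof. by rewrite lee_fin !mulr_ge0// powR_ge0. Qed.

Let measurable_moment r :
  measurable_fun setT (fun h => (enorm h `^ p * nu (enorm h) * (enorm h <= r)%R%:R)%:E).
Proof.
apply/measurable_EFinP; apply: measurable_funM; first exact: measurable_funM.
exact: measurable_natr_bool.
Qed.

Lemma moment_fin (r : R) : (0 < r)%R -> (r <= 1)%R -> moment r \is a fin_num.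
Proof.
move=> r0 r1; rewrite ge0_fin_numE; last by apply: integral_ge0 => h _.
apply: (@le_lt_trans _ _ (1 * I0)%:E); last exact: ltry.
apply: le_min_integral => [//||x|x].
- by apply/measurable_EFinP; exact: measurable_moment.
- by have := moment_integrand_ge0 r x; rewrite lee_fin.
- rewrite mul1r; case: (leP (enorm x) r) => x1; last by rewrite mulr0 mulr_ge0.
  rewrite mulr1 ler_wpM2r// le_min lexx andbT.
  have -> : (1 = (1 : R) `^ p)%R by rewrite powR1.
  by apply: powR_le; rewrite ?enorm_ge0 ?(ltW p_gt0)//; lra.
Qed.

(* Rescaling by [M] gives [moment (r / M) <= moment r / 2], so the moment over
   the ball is comparable with the moment over the outermost shell. *)
Lemma moment_le : (b < d%:R + p)%R -> exists c : R, (0 < c)%R /\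
  forall r : R, (0 < r)%R -> (r <= 1)%R -> (r < R0)%R ->
  moment r <= (c * (r `^ p * nu r * r ^+ d))%:E.
Proof.
move=> bdp; have [M [M2 HM]] := powR_large (2 * C0) bdp.
have M0 : (0 < M)%R by lra.
have Mb0 : (0 < C0 * M `^ b)%R by rewrite mulr_gt0 ?powR_gt0.
exists (2 * (C0 * M `^ b * v0))%R; split; first by rewrite !mulr_gt0 ?powR_gt0.
move=> r r0 r1 rR; have rp0 := powR_gt0 p r0.
have m0 : 0 <= moment r by apply: integral_ge0 => h _; exact: moment_integrand_ge0.
(* The substitution h -> h/M yields M^(-d) from the volume, M^(-p) from the power and at most C0 M^b
   from [nu]; the choice of [M] makes the product at most 1/2. *)
have half : moment (r / M)%R <= 2^-1%:E * moment r.
  have t0 : (M^-1 != 0)%R by rewrite invr_eq0 lt0r_neq0.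
  have t00 : (0 < M^-1)%R by rewrite invr_gt0.
  have E := ge0_integral_affine_rV 0%R t0 (@measurable_moment (r / M)%R) (moment_integrand_ge0 (r / M)%R).
  rewrite {1}/moment -E gtr0_norm//.
  apply: (@le_trans _ _ ((M^-1 ^+ d)%:E * ((M^-1 `^ p * (C0 * M `^ b))%:E * moment r))).
    apply: lee_wpmul2l; first by rewrite lee_fin exprn_ge0// ltW.
    rewrite -ge0_integralZ//; last by rewrite mulr_ge0 ?powR_ge0// ltW.
    apply: le_ge0_integral => [||h|h].
    + exact: (measurableT_comp (@measurable_moment (r / M)%R) (measurable_affine_rV M^-1 0%R)).
    + exact: measurable_funeM.
    + exact: moment_integrand_ge0.
    rewrite -EFinM lee_fin addr0 enormZ gtr0_norm//.
    rewrite [X in (X <= _ / _)%R]mulrC ler_pM2r//.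
    case: (leP (enorm h) r) => hr; last by rewrite !mulr0.
    rewrite !mulr1 powRM ?enorm_ge0 ?(ltW t00)// -!mulrA.
    apply: ler_wpM2l; first exact: powR_ge0.
    have [->|h0] := eqVneq (enorm h) 0%R.
      by rewrite powR0 ?lt0r_neq0// !(mul0r, mulr0).
    have h00 : (0 < enorm h)%R by rewrite lt_def h0 enorm_ge0.
    rewrite [leRHS](_ : _ = enorm h `^ p * (C0 * M `^ b * nu (enorm h)))%R; last by ring.
    apply: ler_wpM2l; first exact: powR_ge0.
    apply: (nu_ratio nu_ge0 C0_gt0 b_gt0 nu_scal).
    - exact: mulr_gt0.
    - by rewrite ler_piMl ?(ltW h00)// invf_le1//; lra.
    - exact: le_lt_trans hr rR.
    - by rewrite mulrA mulfV ?mul1r// lt0r_neq0.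
  rewrite muleA -EFinM; apply: lee_wpmul2r => //; rewrite lee_fin.
  have Md0 : (0 < M ^+ d)%R by rewrite exprn_gt0.
  have Mp0 : (0 < M `^ p)%R by rewrite powR_gt0.
  have -> : (M^-1 `^ p = (M `^ p)^-1)%R.
    by rewrite -powR_inv1 ?(ltW M0)// -powRrM mulN1r powRN.
  rewrite exprVn !ler_pdivrMl//.
  move: HM; rewrite powRD ?powR_mulrn ?(ltW M0)//; last by rewrite (lt0r_neq0 M0) implybT.
  by move=> ?; lra.
have c0 : (0 <= r `^ p * (C0 * M `^ b * nu r))%R by rewrite !mulr_ge0 ?powR_ge0// ltW.
have mB : measurable_fun setT (fun h => (r `^ p * (C0 * M `^ b * nu r) * (enorm h <= r)%R%:R)%:E).
  by apply/measurable_EFinP; apply: measurable_funM => //; exact: measurable_natr_bool.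
(* On r/M < |h| <= r one has |h|^p <= r^p and nu(|h|) <= C0 M^b nu(r). *)
have split : moment r <= moment (r / M)%R + (r `^ p * (C0 * M `^ b * nu r) * (v0 * r ^+ d))%:E.
  rewrite -(integral_ball ballE)// -ge0_integralD//; last first.
    by move=> h _; rewrite lee_fin mulr_ge0.
  apply: le_ge0_integral => [||h|h].
  - exact: measurable_moment.
  - by apply: emeasurable_funD => //; exact: measurable_moment.
  - exact: moment_integrand_ge0.
  rewrite -EFinD lee_fin; case: (leP (enorm h) r) => hr; last first.
    by rewrite !mulr0 addr_ge0 ?mulr_ge0 ?powR_ge0.
  rewrite !mulr1; case: (leP (enorm h) (r / M)%R) => hrM.
    by rewrite mulr1 lerDl.
  rewrite mulr0 add0r; apply: ler_pM => //; first exact: powR_ge0.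
    by apply: powR_le => //; [exact: ltW|exact: enorm_ge0].
  have h0 : (0 < enorm h)%R by apply: lt_trans hrM; rewrite divr_gt0.
  apply: (nu_ratio nu_ge0 C0_gt0 b_gt0 nu_scal) => //.
  by rewrite mulrC -ler_pdivrMr// ltW.
(* Finiteness allows half of the moment to be moved to the left. *)
have mf := moment_fin r0 r1.
have : moment r <= 2^-1%:E * moment r + (r `^ p * (C0 * M `^ b * nu r) * (v0 * r ^+ d))%:E.
  by apply: (le_trans split); rewrite leeD2r.
rewrite -(fineK mf) -EFinM -EFinD !lee_fin => H; lra.
Qed.

(** Splitting at |h| = r bounds [hfun] by the tail plus r^(-p) times the moment, and the powers r^p
    cancel. *)
Lemma hfun_near : (b < d%:R + p)%R -> exists c : R, (0 < c)%R /\
  forall r : R, (0 < r)%R -> (r <= 1)%R -> (r < R0)%R ->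
  hfun (d := d) nu p r <= @tail R d nu r + (c * (nu r * r ^+ d))%:E.
Proof.
move=> bdp; have [c [c0 Hc]] := moment_le bdp; exists c; split => // r r0 r1 rR.
have rp0 := powR_gt0 p r0.
apply: (@le_trans _ _ (@tail R d nu r + ((r `^ p)^-1)%:E * moment r)); last first.
  rewrite leeD2l//; apply: (@le_trans _ _ (((r `^ p)^-1)%:E * (c * (r `^ p * nu r * r ^+ d))%:E)).
    by rewrite lee_wpmul2l ?lee_fin ?invr_ge0 ?(ltW rp0)// Hc.
  rewrite -EFinM lee_fin le_eqVlt; apply/orP; left; apply/eqP; field.
  exact: lt0r_neq0.
rewrite -ge0_integralZ ?invr_ge0 ?(ltW rp0)// -ge0_integralD//; last 4 first.
- by move=> h _; exact: nu_bool_ge0.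
- exact: measurable_nu_bool.
- by move=> h _; rewrite mule_ge0 ?lee_fin ?invr_ge0 ?(ltW rp0)//; exact: moment_integrand_ge0.
- exact: measurable_funeM.
apply: le_ge0_integral => [||h|h].
- by apply/measurable_EFinP; apply: measurable_funM => //; apply: measurable_minr => //; exact: measurable_funM.
- by apply: emeasurable_funD; [exact: measurable_nu_bool|exact: measurable_funeM].
- by rewrite lee_fin mulr_ge0// le_min ler01 divr_ge0 ?powR_ge0.
rewrite -EFinM -EFinD lee_fin; case: (leP (enorm h) r) => hr.
  by rewrite mulr0 add0r mulr1 mulrA ler_wpM2r// mulrC ge_min lexx orbT.
by rewrite mulr0 mulr0 addr0 mulr1 ler_piMl// ge_min lexx.
Qed.

End weight.

(** * The weighted inequality for an everywhere non-negative profile *)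

Section hardy.
Context {R : realType} {d : nat}.
Local Open Scope ereal_scope.
Local Notation mu := (lebesgue_rV R d).
Local Notation V := 'rV[R]_d.

Lemma measurable_hfun (nu : R -> R) (p : R) : (forall r, 0 <= nu r)%R ->
  measurable_fun setT (fun x : V => nu (enorm x)) ->
  measurable_fun setT (fun x : V => hfun (d := d) nu p (enorm x)).
Proof.
move=> nu0 mnu.
pose F (z : V * V) := (Num.min 1 (enorm z.2 `^ p / enorm z.1 `^ p) * nu (enorm z.2))%:E.
have F0 z : 0 <= F z.
  by rewrite lee_fin mulr_ge0// le_min ler01 divr_ge0 ?powR_ge0.
have me q : measurable_fun setT (fun x : V => enorm x `^ q)%R.
  exact: (measurableT_comp (measurable_powR q) measurable_enorm).
have mF : measurable_fun setT F.
  apply/measurable_EFinP; apply: measurable_funM; last exact: (measurableT_comp mnu measurable_snd).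
  apply: measurable_minr => //; apply: measurable_funM.
    exact: (measurableT_comp (me p) measurable_snd).
  under eq_fun do rewrite -powRN.
  exact: (measurableT_comp (me (- p)%R) measurable_fst).
exact: (measurable_integral_snd mF F0).
Qed.

(** A convention, since division by 0 yields 0. It disposes of the origin in
    [integral_le_punctured]. *)
Lemma hfun0 (nu : R -> R) (p : R) : (0 < p)%R -> hfun (d := d) nu p 0 = 0.
Proof.
move=> p0; apply: integral0_eq => x _.
by rewrite powR0 ?lt0r_neq0// invr0 mulr0 min_r// mul0r.
Qed.

Lemma hfun_ge0 (nu : R -> R) (p r : R) : (forall r, 0 <= nu r)%R ->
  0 <= hfun (d := d) nu p r.
Proof.
move=> nu0; apply: integral_ge0 => x _.
by rewrite lee_fin mulr_ge0// le_min ler01 divr_ge0 ?powR_ge0.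
Qed.

(** Monotone convergence as the truncation decreases to 0; F 0 = 0 settles the origin, which no
    truncation reaches. *)
Lemma integral_le_punctured (F : V -> \bar R) (A : \bar R) (e : R) : (0 < e)%R ->
  measurable_fun setT F -> (forall x, 0 <= F x) -> F 0%R = 0 ->
  (forall t, (0 < t < e)%R -> \int[mu]_x (F x * (t < enorm x)%R%:R%:E) <= A) ->
  \int[mu]_x F x <= A.
Proof.
move=> e0 mF F0 F00 HA.
(* The shift by 2 keeps [t n] strictly below [e] already at n = 0. *)
pose t n : R := (e / n.+2%:R)%R.
have t0 n : (0 < t n)%R by rewrite divr_gt0.
have te n : (t n < e)%R by rewrite ltr_pdivrMr// ltr_pMr// ltr1n.
pose g n x := F x * (t n < enorm x)%R%:R%:E.
have g0 n x : 0 <= g n x by rewrite mule_ge0 ?lee_fin.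
have mg n : measurable_fun setT (g n).
  apply: emeasurable_funM => //; apply/measurable_EFinP; apply: measurable_natr_bool.
  by case: (@measurable_enorm_bool R d (t n)).
have ndg x : {homo g ^~ x : n m / (n <= m)%N >-> n <= m}.
  move=> n m nm; rewrite /g lee_wpmul2l// lee_fin ler_nat.
  case: (ltP (t n) (enorm x)) => // H; rewrite (_ : (t m < enorm x)%R = true)//.
  apply: le_lt_trans H; rewrite ler_wpM2l ?(ltW e0)// lef_pV2 ?posrE//.
  by rewrite ler_nat.
rewrite (_ : \int[mu]_x F x = \int[mu]_x limn (g ^~ x)); last first.
  apply: eq_integral => x _; apply/esym/lim_near_cst => //.
  have [->|x0] := eqVneq x 0%R.
    by near=> n; rewrite /g F00 mul0e.
  have {}x0 : (0 < enorm x)%R by rewrite lt_def enorm_eq0 x0 enorm_ge0.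
  near=> n; rewrite /g (_ : (t n < enorm x)%R = true) ?mule1//.
  rewrite /t ltr_pdivrMr// mulrC -ltr_pdivrMr//.
  apply: (@lt_trans _ _ n%:R); last by rewrite ltr_nat.
  near: n; exact: nbhs_infty_gtr.
rewrite monotone_convergence; [|exact: measurableT|exact: mg|by move=> n x _; exact: g0|by move=> x _; exact: ndg].
apply: lime_le.
  apply: ereal_nondecreasing_is_cvgn => n m nm.
  by apply: le_ge0_integral => // x; exact: ndg.
by apply: nearW => n; apply: HA; rewrite t0 te.
Unshelve. all: by end_near.
Qed.

Context (d_gt0 : (0 < d)%N).
Context (nu : R -> R) (nu_ge0 : forall r, (0 <= nu r)%R).
Context (mnu : measurable_fun setT (fun x : V => nu (enorm x))).
Context (C0 b R0 : R) (C0_gt0 : (0 < C0)%R) (b_gt0 : (0 < b)%R) (R0_gt0 : (0 < R0)%R).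
Context (nu_scal : forall s r : R, (0 < s)%R -> (s <= r)%R -> (r < R0)%R ->
  (nu s <= C0 * (r / s) `^ b * nu r)%R).
Context (p : R) (p_gt0 : (0 < p)%R).
Context (I0 : R)
  (nu_int : \int[mu]_x (Num.min 1 (enorm x `^ p) * nu (enorm x))%:E <= I0%:E).

(** For fixed [t], absorption bounds the integral of |f|^p against the weight [W] of the jump
    kernel; [W] dominates [hfun] for t < |x| < e, and [hfun] is bounded for |x| >= e. The constants
    are fixed before [t], which may then tend to 0. *)
Lemma hardy_profile : (b < d%:R + d%:R)%R -> (b < d%:R + p)%R ->
  exists c : R, (0 < c)%R /\ forall f : V -> R,
  measurable_fun setT f -> \int[mu]_x (`|f x| `^ p)%:E < +oo ->
  \int[mu]_x ((`|f x| `^ p)%:E * hfun (d := d) nu p (enorm x)) <=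
  c%:E * \int[mu]_h ((\int[mu]_x (`|f (x + h)%R - f x| `^ p)%:E) * (nu (enorm h))%:E)
  + c%:E * \int[mu]_x (`|f x| `^ p)%:E.
Proof.
move=> bdd bdp.
have [v0 [v0_gt0 ballE]] := @ball_volume R d.
have [M [M2 HM]] := landing_factor C0_gt0 b_gt0 bdd.
have [C [C_gt0 HC]] := @kernel_absorption R d p p_gt0.
have [c [c_gt0 Hc]] := hfun_near v0_gt0 ballE nu_ge0 mnu C0_gt0 b_gt0 nu_scal p_gt0 nu_int bdp.
have I00 : (0 <= I0)%R.
  rewrite -lee_fin; apply: le_trans nu_int; apply: integral_ge0 => x _.
  by rewrite lee_fin mulr_ge0// le_min ler01 powR_ge0.
have P2d : (1 <= 2 ^+ d - 1 :> R)%R.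
  rewrite lerBrDr -[leLHS]/(2%:R)%R -natrX ler_nat.
  by rewrite -{1}(expn1 2) leq_exp2l.
have Md0 : (0 < M ^+ d)%R by rewrite exprn_gt0//; lra.
have M1d0 : (0 < (M - 1) ^+ d)%R by rewrite exprn_gt0//; lra.
(* The bound by 1 serves [tail_le] and [hfun_far]; the extra factor 2 makes (2M + 1) e < R0
   strict. *)
pose e := (Num.min 1 (R0 / (2 * (2 * M + 1))))%R.
have M0 : (0 < 2 * (2 * M + 1))%R by lra.
have e0 : (0 < e)%R by rewrite lt_min ltr01 divr_gt0.
have e1 : (e <= 1)%R by rewrite ge_min lexx.
have eR : ((2 * M + 1) * e < R0)%R.
  have : (e <= R0 / (2 * (2 * M + 1)))%R by rewrite ge_min lexx orbT.
  by rewrite ler_pdivlMr// => H; move: R0_gt0; lra.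
pose c1 := (C0 * 2 `^ b * v0)%R.
have c10 : (0 < c1)%R by rewrite !mulr_gt0 ?powR_gt0.
pose jw := (v0 * (2 ^+ d - 1) * M ^+ d)%R.
have jw0 : (0 < jw)%R by rewrite !mulr_gt0//; lra.
(* This makes the far-jump weight equal to [c1] times [core], with [c1] the loss coefficient of
   [tail_half_le]. The condition of [jump_landing] becomes c1/2 + q <= 5/8 c1. *)
pose L := (c1 / jw)%R.
have L0 : (0 <= L)%R by rewrite divr_ge0// ltW.
have Ljw : (L * jw = c1)%R by rewrite /L divfK// lt0r_neq0.
have rat0 a : (0 <= C0 * a `^ b)%R by rewrite mulr_ge0 ?powR_ge0// ltW.
pose q := (L * (C0 * (2 * M + 1) `^ b) * v0 / (M - 1) ^+ d)%R.
have q0 : (0 <= q)%R.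
  apply: divr_ge0; last exact: ltW.
  by apply: mulr_ge0; [exact: mulr_ge0|exact: ltW].
(* The volume [v0] cancels, 2^d - 1 >= 1 because d > 0, and the remaining quotient is at most 1/8 by
   the choice of [M]. *)
have Hq : (q <= 8^-1 * c1)%R.
  have -> : (q = c1 / (2 ^+ d - 1) * ((C0 * (2 * M + 1) `^ b) / (M ^+ d * (M - 1) ^+ d)))%R.
    rewrite /q /L /jw; field; rewrite !lt0r_neq0//; lra.
  rewrite [leRHS]mulrC; apply: ler_pM.
  - by rewrite divr_ge0 ?(ltW c10)//; lra.
  - by rewrite divr_ge0 ?mulr_ge0 ?powR_ge0 ?(ltW C0_gt0) ?(ltW Md0) ?(ltW M1d0).
  - by rewrite ler_pdivrMr; [rewrite ler_peMr// ltW|lra].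
  - by rewrite ler_pdivrMr// mulr_gt0.
pose T := (((e / 2) `^ p)^-1 * I0)%R.
have T0 : (0 <= T)%R by rewrite mulr_ge0 ?invr_ge0 ?powR_ge0.
have tT : @tail R d nu (e / 2)%R <= T%:E.
  by apply: (tail_le nu_ge0 mnu p_gt0 nu_int); lra.
pose K := (1 + L * (C0 * (2 * M) `^ b))%R.
have K0 : (0 <= K)%R by apply: addr_ge0 => //; exact: mulr_ge0.
pose r1 := ((2 * M + 1) * e)%R.
have r10 : (0 <= r1)%R by rewrite mulr_ge0 ?(ltW e0)//; lra.
pose B := (2^-1 * T + q * (C0 * (2 * M + 1) `^ b * nu r1 * r1 ^+ d))%R.
have B0 : (0 <= B)%R.
  apply: addr_ge0; first by rewrite mulr_ge0.
  by do 2 apply: mulr_ge0 => //; [exact: mulr_ge0|exact: exprn_ge0].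
(* The summand 1 covers the tail in [hfun_near], and c/c1 converts the coefficient [c1] of [core]
   into [c]. *)
pose Cw := (1 + c / c1)%R.
have Cw0 : (0 <= Cw)%R by rewrite addr_ge0// divr_ge0// ltW.
pose B3 := ((e `^ p)^-1 * I0)%R.
have B30 : (0 <= B3)%R by rewrite mulr_ge0 ?invr_ge0 ?powR_ge0.
pose cc := (Cw * (C * K) + Cw * (C * B) + B3 + 1)%R.
have CK0 : (0 <= C * K)%R by apply: mulr_ge0 => //; exact: ltW.
have CB0 : (0 <= C * B)%R by apply: mulr_ge0 => //; exact: ltW.
have p1 : (0 <= Cw * (C * K))%R by exact: mulr_ge0.
have p2 : (0 <= Cw * (C * B))%R by exact: mulr_ge0.
exists cc; split; first by rewrite /cc; lra.
move=> f mf foo.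
pose g x := (`|f x| `^ p)%R.
have g0 x : (0 <= g x)%R by exact: powR_ge0.
have mg : measurable_fun setT g.
  by apply: (measurableT_comp (measurable_powR _)); exact: measurableT_comp.
have mgE : measurable_fun setT (fun x => (g x)%:E) by exact/measurable_EFinP.
have gE0 x : 0 <= (g x)%:E by rewrite lee_fin.
pose S := \int[mu]_h ((\int[mu]_x (`|f (x + h)%R - f x| `^ p)%:E) * (nu (enorm h))%:E).
pose G := \int[mu]_x (`|f x| `^ p)%:E.
rewrite -/S -/G.
have S0 : 0 <= S.
  apply: integral_ge0 => h _; rewrite mule_ge0 ?lee_fin//.
  by apply: integral_ge0 => x _; rewrite lee_fin powR_ge0.
have G0 : 0 <= G by exact: integral_ge0.
have mh := @measurable_hfun nu p nu_ge0 mnu.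
have h0 x : 0 <= hfun (d := d) nu p (enorm x) by exact: hfun_ge0.
apply: (@integral_le_punctured _ _ e) => //.
- exact: emeasurable_funM.
- by move=> x; rewrite mule_ge0.
- have -> : @enorm R d 0%R = 0%R by apply/eqP; rewrite enorm_eq0.
  by rewrite hfun0// mule0.
move=> t /andP[t0 te].
pose W x := \int[mu]_h (jump nu t e M L x h)%:E.
have jE := integral_jump ballE nu_ge0 mnu t0 te M2 eR L0.
have W0 x : 0 <= W x by apply: integral_ge0 => h _; rewrite lee_fin jump_ge0.
have mj := measurable_jump mnu t e M L.
have mW : measurable_fun setT W.
  have mjE : measurable_fun setT (fun z : V * V => (jump nu t e M L z.1 z.2)%:E).
    exact/measurable_EFinP.
  by apply: (measurable_integral_snd mjE) => z; rewrite lee_fin jump_ge0.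
have main : \int[mu]_x ((g x)%:E * W x) <= (C * K)%:E * S + (C * B)%:E * G.
  (* Among the constants passed here, only the bound on the weight depends on [t]. *)
  apply: (HC (fun h => nu (enorm h)) (jump nu t e M L) f K B
     ((t `^ p)^-1 * I0 + c1 * (C0 * (e / t) `^ b * nu e * e ^+ d))%R) => //.
  - by move=> x h; exact: jump_ge0.
  - by move=> x h; exact: (jump_le nu_ge0 C0_gt0 b_gt0 nu_scal t0 te M2 eR L0).
  - move=> x; rewrite jE EFinD; apply: leeD.
      apply: (@le_trans _ _ (tail nu t)).
        by apply: (tail_anti nu_ge0 mnu); rewrite le_max lexx orbT.
      by apply: (tail_le nu_ge0 mnu p_gt0 nu_int) => //; lra.
    rewrite lee_fin -/jw Ljw ler_wpM2l ?(ltW c10)//.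
    exact: (core_le nu_ge0 C0_gt0 b_gt0 nu_scal t0 te M2 eR).
  - move=> y; apply: (jump_landing v0_gt0 ballE nu_ge0 mnu C0_gt0 b_gt0 nu_scal t0 te M2 eR L0 y tT).
    by rewrite -/jw Ljw -/q -/c1; lra.
apply: (@le_trans _ _ (Cw%:E * \int[mu]_x ((g x)%:E * W x) + B3%:E * G)).
  rewrite -ge0_integral_lincomb//; last 2 first.
  - exact: emeasurable_funM.
  - by move=> x; rewrite mule_ge0.
  apply: le_ge0_integral => [||x|x].
  - apply: emeasurable_funM; first exact: emeasurable_funM.
    apply/measurable_EFinP; apply: measurable_natr_bool.
    by case: (@measurable_enorm_bool R d t).
  - apply: emeasurable_funD; apply: measurable_funeM => //; exact: emeasurable_funM.
  - by rewrite !mule_ge0// lee_fin.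
  have -> : Cw%:E * ((g x)%:E * W x) + B3%:E * (g x)%:E = (g x)%:E * (Cw%:E * W x + B3%:E).
    have w1 : 0 <= Cw%:E * W x by rewrite mule_ge0 ?lee_fin.
    have w2 : 0 <= B3%:E by rewrite lee_fin.
    by rewrite (ge0_muleDr _ w1 w2) muleCA (muleC B3%:E).
  rewrite -muleA.
  apply: lee_wpmul2l; first exact: gE0.
  case: (ltP t (enorm x)) => tx; last by rewrite mule0 adde_ge0 ?mule_ge0 ?lee_fin.
  rewrite mule1; have [xe|xe] := ltP (enorm x) e; last first.
    apply: (@le_trans _ _ B3%:E); last by rewrite leeDr// mule_ge0 ?lee_fin.
    exact: (hfun_far nu_ge0 mnu p_gt0 nu_int).
  apply: (@le_trans _ _ (Cw%:E * W x)); last by rewrite leeDl// lee_fin.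
  have x0 : (0 < enorm x)%R by lra.
  have xR : (enorm x < R0)%R by nra.
  apply: (le_trans (Hc _ x0 _ xR)); first by lra.
  rewrite /W jE -/jw Ljw max_l ?(ltW tx)// /core tx xe/= mulr1.
  have n0 : (0 <= nu (enorm x) * enorm x ^+ d)%R by rewrite mulr_ge0// exprn_ge0// ltW.
  have w1 : 0 <= @tail R d nu (enorm x) by exact: tail_ge0.
  have w2 : 0 <= (c1 * (nu (enorm x) * enorm x ^+ d))%:E.
    by rewrite lee_fin mulr_ge0// ltW.
  rewrite (ge0_muleDr _ w1 w2); apply: leeD.
    rewrite -[leLHS]mul1e; apply: lee_wpmul2r => //.
    by rewrite lee_fin /Cw lerDl divr_ge0// ltW.
  rewrite -EFinM lee_fin [leRHS]mulrA ler_wpM2r// /Cw mulrDl mul1r divfK ?lt0r_neq0//.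
  by rewrite lerDr ltW.
have G_fin : G \is a fin_num by rewrite ge0_fin_numE.
apply: (@le_trans _ _ (Cw%:E * ((C * K)%:E * S + (C * B)%:E * G) + B3%:E * G)).
  by rewrite leeD2r// lee_wpmul2l ?lee_fin.
have s1 : 0 <= (C * K)%:E * S by rewrite mule_ge0 ?lee_fin.
have s2 : 0 <= (C * B)%:E * G by rewrite mule_ge0 ?lee_fin.
rewrite (ge0_muleDr _ s1 s2) -addeA; apply: leeD.
  by rewrite muleA -EFinM lee_wpmul2r// lee_fin /cc; lra.
rewrite muleA -EFinM -ge0_muleDl ?lee_fin//.
by rewrite -EFinD lee_wpmul2r// lee_fin /cc; lra.
Qed.

End hardy.

(** Inverting the index inequality for an admissible a > -m gives the exponent -a < m. Its maximum
    with m/2 is positive and still below m, and enlarging the exponent is harmless as r/s >= 1. *)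
Lemma Matuszewska_scaling (R : realType) (nu : R -> R) (m : R) : 0 < m ->
  (forall r, 0 < r -> 0 <= nu r) -> ((- m)%:E < lower_Matuszewska0 nu)%E ->
  exists C b R0 : R, [/\ 0 < C, 0 < b, b < m, 0 < R0 &
    forall s r : R, 0 < s -> s <= r -> r < R0 ->
      nu s <= C * (r / s) `^ b * nu r].
Proof.
move=> m0 nu0 /ereal_sup_gt[_ [a [A [R0 [A0 R00 H]]] <-]]; rewrite lte_fin => ma.
exists (Num.max 1 A^-1), (Num.max (- a) (m / 2)), R0; split => //.
- by rewrite lt_max ltr01.
- by rewrite lt_max; apply/orP; right; lra.
- by rewrite gt_max; apply/andP; split; lra.
set b := Num.max (- a) _ => s r s0 sr rR.
have r0 : 0 < r by lra.
have nr := nu0 _ r0.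
have rs : 1 <= r / s by rewrite ler_pdivlMr// mul1r.
(* The index compares distinct points only; s = r is covered by C >= 1. *)
have [rs1|rs1] := eqVneq s r.
  rewrite rs1 divff ?lt0r_neq0// powR1 mulr1 -[leLHS]mul1r ler_wpM2r//.
  by rewrite le_max lexx.
have {}sr : s < r by rewrite lt_def eq_sym rs1.
have Ars : 0 < A * (r / s) `^ a by rewrite mulr_gt0// powR_gt0//; lra.
have Hsr := H _ _ s0 sr rR.
(* If [nu s] were 0, the quotient would be 0 by convention, against its positive lower bound. *)
have ns : 0 < nu s.
  rewrite lt_def nu0// andbT; apply/eqP => ns.
  by move: Hsr; rewrite ns invr0 mulr0 leNgt Ars.
move: Hsr; rewrite ler_pdivlMr// -ler_pdivlMl// => Hsr.
apply: (le_trans Hsr); apply: ler_wpM2r => //.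
rewrite invfM -powRN; apply: ler_pM; rewrite ?invr_ge0 ?powR_ge0 ?(ltW A0)//.
  by rewrite le_max lexx orbT.
by apply: ler_powR => //; rewrite le_max lexx.
Qed.

(** * Replacing the profile by one that is non-negative at the origin too *)

Section nonneg_profile.
Context {R : realType} {d : nat}.
Local Open Scope ereal_scope.
Local Notation mu := (lebesgue_rV R d).

(* The hypotheses leave the profile unconstrained at [0]. *)
Definition nonneg_profile (nu : R -> R) (r : R) : R := (Num.max 0 (nu r))%R.

Lemma nonneg_profileE (nu : R -> R) (r : R) :
  (forall r, 0 < r -> 0 <= nu r)%R -> (0 < r)%R -> nonneg_profile nu r = nu r.
Proof. by move=> nu0 r0; rewrite /nonneg_profile max_r// nu0. Qed.

Context (nu : R -> R) (nu_ge0 : forall r, (0 < r)%R -> (0 <= nu r)%R).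
Context (p : R) (p_gt0 : (0 < p)%R).

(** At x = 0 the minimum vanishes because p > 0, which hides the value of the profile there. *)
Lemma min_nonneg_profile (r : R) (x : 'rV[R]_d) :
  (Num.min 1 (enorm x `^ p / r) * nonneg_profile nu (enorm x))%R =
  (Num.min 1 (enorm x `^ p / r) * nu (enorm x))%R.
Proof.
have [->|x0] := eqVneq (enorm x) 0%R.
  by rewrite powR0 ?lt0r_neq0// mul0r min_r// !mul0r.
by rewrite nonneg_profileE// lt_def x0 enorm_ge0.
Qed.

Lemma hfun_nonneg_profile (r : R) :
  hfun (d := d) (nonneg_profile nu) p r = hfun (d := d) nu p r.
Proof. by apply: eq_integral => x _; rewrite min_nonneg_profile. Qed.

(** At h = 0 the increments of f vanish, and with them the inner integral. *)
Lemma seminorm_nonneg_profile (f : 'rV[R]_d -> R) :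
  \int[mu]_h ((\int[mu]_x (`|f (x + h)%R - f x| `^ p)%:E)
    * (nonneg_profile nu (enorm h))%:E) =
  \int[mu]_h ((\int[mu]_x (`|f (x + h)%R - f x| `^ p)%:E) * (nu (enorm h))%:E).
Proof.
apply: eq_integral => h _; have [->|h0] := eqVneq h 0%R; last first.
  by rewrite nonneg_profileE// lt_def enorm_eq0 h0 enorm_ge0.
rewrite (_ : \int[mu]_x _ = 0) ?mul0e//; apply: integral0_eq => x _.
by rewrite addr0 subrr normr0 powR0// lt0r_neq0.
Qed.

End nonneg_profile.

Theorem theorem3p4 (R : realType) (d : nat) (p : R) (nu : R -> R) :
  (0 < d)%N -> 1 <= p ->
  (forall r : R, 0 < r -> 0 <= nu r) ->
  measurable_fun [set: 'rV[R]_d] (fun x : 'rV[R]_d => nu (enorm x)) ->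
  (\int[lebesgue_rV R d]_x
     (Num.min 1 (enorm x `^ p) * nu (enorm x))%:E < +oo)%E ->
  ((- d%:R - 1)%:E < lower_Matuszewska0 nu)%E ->
  exists c : R, 0 < c /\
    forall f : 'rV[R]_d -> R, spaceW nu p f ->
      (\int[lebesgue_rV R d]_x ((`|f x| `^ p)%:E * hfun (d := d) nu p (enorm x))
        <= c%:E * normW nu p f `^ p)%E.
Proof.
move=> d0 p1 nu0 mnu nu_int nu_idx.
have p0 : 0 < p by lra.
have d1 : 1 <= d%:R :> R by rewrite ler1n.
have m0 : 0 < d%:R + 1 :> R by lra.
have [C [b [R0 [C0 b0 bm R00 scal]]]] : exists C b R0 : R,
    [/\ 0 < C, 0 < b, b < d%:R + 1, 0 < R0 &
    forall s r : R, 0 < s -> s <= r -> r < R0 -> nu s <= C * (r / s) `^ b * nu r].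
  by apply: Matuszewska_scaling => //; rewrite opprD.
pose nu' := nonneg_profile nu.
have nu'E r : 0 < r -> nu' r = nu r by exact: nonneg_profileE.
have nu'0 r : 0 <= nu' r by rewrite /nu' /nonneg_profile le_max lexx.
have mnu' : measurable_fun [set: 'rV[R]_d] (fun x : 'rV[R]_d => nu' (enorm x)).
  exact: measurable_maxr.
have scal' s r : 0 < s -> s <= r -> r < R0 -> nu' s <= C * (r / s) `^ b * nu' r.
  by move=> s0 sr rR; rewrite !nu'E//; [exact: scal|exact: lt_le_trans sr].
have int' : (\int[lebesgue_rV R d]_x (Num.min 1 (enorm x `^ p) * nu' (enorm x))%:E <=
    (fine (\int[lebesgue_rV R d]_x (Num.min 1 (enorm x `^ p) * nu (enorm x))%:E))%:E)%E.
  have E : (\int[lebesgue_rV R d]_x (Num.min 1 (enorm x `^ p) * nu' (enorm x))%:E =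
      \int[lebesgue_rV R d]_x (Num.min 1 (enorm x `^ p) * nu (enorm x))%:E)%E.
    apply: eq_integral => x _.
    by have := min_nonneg_profile nu0 p0 1 x; rewrite divr1 => ->.
  rewrite -E fineK// ge0_fin_numE; first by rewrite E.
  by apply: integral_ge0 => x _; rewrite lee_fin mulr_ge0// le_min ler01 powR_ge0.
(* Both conditions b < 2d and b < d + p follow from b < d + 1, as d >= 1 and p >= 1. *)
have [|| c [c0 Hc]] := @hardy_profile R d d0 nu' nu'0 mnu' C b R0 C0 b0 R00 scal' p p0 _ int'.
- by lra.
- by lra.
(* One [c] for the seminorm and one for the L^p norm, since each p-th power is at most that of the
   full norm. *)
exists (c + c); split; first by lra.
move=> f [mf fW]; have pn0 : p != 0 by exact: lt0r_neq0.
set N := normW nu p f in fW *.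
pose G := (\int[lebesgue_rV R d]_x (`|f x| `^ p)%:E)%E.
pose S := (\int[lebesgue_rV R d]_h ((\int[lebesgue_rV R d]_x (`|f (x + h) - f x| `^ p)%:E)
  * (nu (enorm h))%:E))%E.
have S0 : (0 <= S)%E.
  rewrite /S -(seminorm_nonneg_profile nu0 p0); apply: integral_ge0 => h _.
  rewrite mule_ge0 ?lee_fin//; apply: integral_ge0 => x _; rewrite lee_fin; exact: powR_ge0.
have LN : ('N[lebesgue_rV R d]_(p%:E)[EFin \o f] <= N)%E.
  by rewrite /N /normW leeDl// poweR_ge0.
have SN : (S `^ p^-1 <= N)%E by rewrite /N /normW leeDr// Lnorm_ge0.
have N0 : (0 <= N)%E by apply: le_trans SN; exact: poweR_ge0.
have powN x : (0 <= x)%E -> (x <= N)%E -> (x `^ p <= N `^ p)%E.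
  move=> x0 xN; apply: gt0_ler_poweR => //; first exact: ltW.
    by rewrite in_itv/= x0 leey.
  by rewrite in_itv/= N0 leey.
have GN : (G <= N `^ p)%E.
  rewrite (_ : G = 'N[lebesgue_rV R d]_(p%:E)[EFin \o f] `^ p)%E.
    by apply: powN => //; exact: Lnorm_ge0.
  by rewrite poweR_Lnorm.
have SN' : (S <= N `^ p)%E.
  rewrite -[leLHS](poweRe1 S0) -(mulVf pn0) poweRrM.
  by apply: powN => //; exact: poweR_ge0.
(* Membership in the space gives the integrability of |f|^p that the absorption requires. *)
have Goo : (G < +oo)%E by apply: le_lt_trans GN _; exact: poweR_lty.
have := Hc f mf Goo; rewrite seminorm_nonneg_profile// -/S -/G.
under eq_integral do rewrite hfun_nonneg_profile//.
move=> /le_trans; apply; rewrite EFinD ge0_muleDl ?lee_fin ?(ltW c0)//.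
by apply: leeD; apply: lee_wpmul2l; rewrite ?lee_fin ?(ltW c0).
Qed.
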